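(* Let $f:\mathbb{R}^n\to\mathbb{R}$ be continuously differentiable, let $r>0$, and let $x^\star\in\mathbb{R}^n$ satisfy $\nabla f(x^\star)=0$. Assume: (A1) $\nabla f$ is Lipschitz continuous on $\mathbb{R}^n$ with constant $L>0$; (A2) $f$ is $\mu$-strongly convex on $\mathbb{B}_r(x^\star)$ for some $\mu>0$; (A3) the Hessian $\nabla^2 f$ exists and is Lipschitz continuous with modulus $L_H$ on $\mathbb{B}_r(x^\star)$. Let $m\ge 1$ be an integer and $M>0$. Then there exist a neighborhood $U$ of $x^\star$ and a constant $C>0$ such that the following holds. If $\{x^k\}_{k\ge 0}$ is generated by Algorithm AA-R (Anderson acceleration with restarting, see context) with memory parameter $m$, if $x^0\in U$, and if the condition number of $X_k^\top X_k$ is bounded by $M^2$ for every $k\in\mathbb{N}$, then $$ f(x^{k+1})\le f(g(x^k)) + C\,\|\nabla f(x^{k-\hat m})\|^3 \qquad\text{for all } k\in\mathbb{N}, $$ where $\hat m=\mathrm{mod}(k,m+1)$ (that is, $f(x^{k+1})\le f(g(x^k))+\mathcal{O}(\|\nabla f(x^{k-\hat m})\|^3)$).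
   Context: $\mathbb{B}_r(x^\star)=\{x:\|x-x^\star\|<r\}$; $\|\cdot\|$ is the Euclidean norm (spectral norm for matrices); $\mathbb{N}$ includes $0$. Define $g(x)=x-\frac1L\nabla f(x)$, $h(x)=g(x)-x=-\frac1L\nabla f(x)$, $g^k=g(x^k)$, $h^k=h(x^k)$. For a sequence $\{x^k\}$ and an index $k$, put $\hat m=\mathrm{mod}(k,m+1)$ (so $\hat m$ depends on $k$) and $X_k=[x^{k-\hat m+1}-x^{k-\hat m},\dots,x^k-x^{k-\hat m}]$, $H_k=[h^{k-\hat m+1}-h^{k-\hat m},\dots,h^k-h^{k-\hat m}]$, $G_k=[g^{k-\hat m+1}-g^{k-\hat m},\dots,g^k-g^{k-\hat m}]$, all in $\mathbb{R}^{n\times\hat m}$. Condition number of a matrix $A$: $\kappa(A)=\sigma_{\max}(A)/\sigma_{\min}(A)$ ($+\infty$ if $\sigma_{\min}(A)=0$). Conditions on $X_k$ are void when $\hat m=0$ (empty matrix). Algorithm AA-R: given $x^0\in\mathbb{R}^n$ and memory parameter $m$, for $k=0,1,\dots$ let $\hat m=\mathrm{mod}(k,m+1)$. If $\hat m=0$, set $x^{k+1}=g(x^k)$. Otherwise let $\alpha^k\in\mathbb{R}^{\hat m}$ be a solution of $\min_{\alpha}\|h^{k-\hat m}+H_k\alpha\|^2$ and set $x^{k+1}=g^{k-\hat m}+G_k\alpha^k$. *)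

(* Defs.v *)
From mathcomp Require Import all_boot all_order all_algebra.
From mathcomp Require Import all_classical all_reals all_analysis.
Import Order.TTheory GRing.Theory Num.Theory.
Import numFieldNormedType.Exports.

Set Implicit Arguments.
Unset Strict Implicit.
Unset Printing Implicit Defensive.

Local Open Scope classical_set_scope.
Local Open Scope ring_scope.

(* The library's norm `|x| on 'cV[R]_n is the max norm. It induces the same
   topology and the same derivatives, so the library notions [nbhs],
   [continuous], [differentiable] are used as they are, but every metric
   quantity below is stated with the Euclidean norm [enorm]. *)
Definition enorm (R : realType) (n : nat) (x : 'cV[R]_n) : R :=
  Num.sqrt (\sum_(i < n) x i 0 ^+ 2).

Definition eball (R : realType) (n : nat) (c : 'cV[R]_n) (r : R) :
    set 'cV[R]_n :=
  [set x | enorm (x - c) < r].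

(* The set is bounded and contains 0, so [sup] is a genuine supremum. *)
Definition spectral_norm (R : realType) (n p : nat) (A : 'M[R]_(n, p)) : R :=
  sup [set enorm (A *m v) | v in [set v : 'cV[R]_p | enorm v <= 1]].

Definition singular_values (R : realType) (p : nat) (A : 'M[R]_p) : set R :=
  [set Num.sqrt a | a in [set a : R | eigenvalue (A^T *m A) a]].

(* For p > 0 the set of singular values is finite and nonempty, so [sup] and
   [inf] are a maximum and a minimum; for p = 0 these values are junk. *)
Definition sigma_max (R : realType) (p : nat) (A : 'M[R]_p) : R :=
  sup (singular_values A).

Definition sigma_min (R : realType) (p : nat) (A : 'M[R]_p) : R :=
  inf (singular_values A).

Definition cond_number (R : realType) (p : nat) (A : 'M[R]_p) : \bar R :=
  if sigma_min A == 0 then +oo%E else (sigma_max A / sigma_min A)%:E.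

Definition grad (R : realType) (n : nat) (f : 'cV[R]_n -> R) (x : 'cV[R]_n) :
    'cV[R]_n :=
  \col_(i < n) 'D_(delta_mx i 0) f x.

Definition hess (R : realType) (n : nat) (f : 'cV[R]_n -> R) (x : 'cV[R]_n) :
    'M[R]_n :=
  \matrix_(i < n, j < n) 'D_(delta_mx j 0) (fun y => grad f y i 0) x.

Definition continuously_differentiable (R : realType) (n : nat)
    (f : 'cV[R]_n -> R) : Prop :=
  (forall x, differentiable f x) /\ continuous (grad f).

Definition grad_lipschitz (R : realType) (n : nat) (f : 'cV[R]_n -> R)
    (L : R) : Prop :=
  forall x y, enorm (grad f x - grad f y) <= L * enorm (x - y).

Definition strongly_convex_on (R : realType) (n : nat) (D : set 'cV[R]_n)
    (mu : R) (f : 'cV[R]_n -> R) : Prop :=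
  forall x y (t : R), D x -> D y -> 0 <= t <= 1 ->
    f (t *: x + (1 - t) *: y) <=
      t * f x + (1 - t) * f y - mu / 2 * t * (1 - t) * enorm (x - y) ^+ 2.

Definition hess_lipschitz_on (R : realType) (n : nat) (D : set 'cV[R]_n)
    (LH : R) (f : 'cV[R]_n -> R) : Prop :=
  (forall x, D x -> differentiable (grad f) x) /\
  (forall x y, D x -> D y ->
     spectral_norm (hess f x - hess f y) <= LH * enorm (x - y)).

Definition hstep (R : realType) (n : nat) (f : 'cV[R]_n -> R) (L : R)
    (x : 'cV[R]_n) : 'cV[R]_n :=
  - (L^-1 *: grad f x).

Definition gstep (R : realType) (n : nat) (f : 'cV[R]_n -> R) (L : R)
    (x : 'cV[R]_n) : 'cV[R]_n :=
  x - L^-1 *: grad f x.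

(* With k0 = k - mhat and p = mhat, the columns are
   s^{k0+1} - s^{k0}, ..., s^k - s^{k0}. *)
Definition diff_mx (R : realType) (n : nat) (s : nat -> 'cV[R]_n)
    (k0 p : nat) : 'M[R]_(n, p) :=
  \matrix_(i < n, j < p) (s (k0 + j.+1)%N - s k0) i 0.

Definition mhat (m k : nat) : nat := (k %% m.+1)%N.

Definition Xmx (R : realType) (n m : nat) (x : nat -> 'cV[R]_n) (k : nat) :
    'M[R]_(n, mhat m k) :=
  diff_mx x (k - mhat m k) (mhat m k).

Definition Hmx (R : realType) (n : nat) (f : 'cV[R]_n -> R) (L : R) (m : nat)
    (x : nat -> 'cV[R]_n) (k : nat) : 'M[R]_(n, mhat m k) :=
  diff_mx (fun i => hstep f L (x i)) (k - mhat m k) (mhat m k).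

Definition Gmx (R : realType) (n : nat) (f : 'cV[R]_n -> R) (L : R) (m : nat)
    (x : nat -> 'cV[R]_n) (k : nat) : 'M[R]_(n, mhat m k) :=
  diff_mx (fun i => gstep f L (x i)) (k - mhat m k) (mhat m k).

Definition lsq_solution (R : realType) (n p : nat) (b : 'cV[R]_n)
    (A : 'M[R]_(n, p)) (alpha : 'cV[R]_p) : Prop :=
  forall beta : 'cV[R]_p,
    enorm (b + A *m alpha) ^+ 2 <= enorm (b + A *m beta) ^+ 2.

(* A relation rather than a function: the least-squares solution need not be
   unique, and any choice is allowed at every iteration. *)
Definition generated_by_AAR (R : realType) (n : nat) (f : 'cV[R]_n -> R)
    (L : R) (m : nat) (x : nat -> 'cV[R]_n) : Prop :=
  forall k : nat,
    (mhat m k = 0%N -> x k.+1 = gstep f L (x k)) /\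
    ((0 < mhat m k)%N ->
      exists alpha : 'cV[R]_(mhat m k),
        lsq_solution (hstep f L (x (k - mhat m k)%N)) (Hmx f L m x k) alpha /\
        x k.+1 =
          gstep f L (x (k - mhat m k)%N) + Gmx f L m x k *m alpha).

(* Main.v *)
Require Import Defs.
From mathcomp Require Import all_boot all_order all_algebra.
From mathcomp Require Import all_classical all_reals all_analysis.
From mathcomp Require Import ring lra.
Import Order.TTheory GRing.Theory Num.Theory.
Import numFieldNormedType.Exports.

Set Implicit Arguments.
Unset Strict Implicit.
Unset Printing Implicit Defensive.

Local Open Scope classical_set_scope.
Local Open Scope ring_scope.

(** Write A for the Hessian at the minimiser divided by L, so that A is
    symmetric with spectrum in [mu / L, 1], and consider one restart cycle
    y_0, y_1, ..., y_(m+1), with e the distance from y_0 to the minimiser.  With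
    s_j the Anderson correction X alpha and r_j the least-squares residual
    h(y_0) + H alpha of step j, the algorithm reads
      y_(j+1) = y_0 + s_j + r_j,
    and r_j is orthogonal to the columns of H.  Since h is affine with linear
    part - A up to a quadratic error, r_j = r_0 - A s_j up to O(e^2).

    For exactly affine h the iteration is a minimal residual Krylov method.  The
    residuals r_0, r_1, ... are A-orthogonal, r_i . r_j = |r_j|^2 for i <= j,
    and therefore
      s_(p+1) - s_p = (|r_p|^2 - |r_(p+1)|^2) sum_(i <= p) r_i / (r_i . A r_i).
    All coefficients are nonnegative, and the last one is at least 1 because
    residual minimisation beats one plain step: |r_(p+1)| <= |r_p - A r_p|, while
    A^2 <= A.  Up to O(e^3), the difference f(g(y_(p+1))) - f(y_(p+2)) is at
    least L times
      <(I - A) r_(p+1), (I - A) w>,   w = s_(p+1) - s_p - r_p,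
    which expands into a combination of nonnegative quantities
    ([krylov_descent]).

    The nonlinear problem follows the same computation with vectors known modulo
    O(e^2) and inner products modulo O(e^3).  The condition number enters twice.
    It keeps the coefficients alpha bounded ([cycle_boundsP]), and it bounds
    |r_j| below by a multiple of e ([cyc_r_lb]), so that dividing by r_j . A r_j
    loses exactly the factor e^2 that the numerators contain.  Both use that the
    first column of X is h(y_0), whose norm is of order e.

    Constants are not tracked: a cycle is an element of a type T, e is a function
    on T, and every estimate is of the form: there is a constant such that the
    bound holds on all cycles with e small ([isO], [Oge]).

    All cycles stay in the region where these estimates are valid because
    |h| does not increase from the start of one cycle to the next
    ([cyc_next_contract]) and is comparable with the distance to the
    minimiser. *)

(** * Euclidean geometry of column vectors *)

Section EuclideanGeometry.
Variables (R : realType) (n : nat).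
Implicit Types (u v w : 'cV[R]_n) (a : R).

Definition vdot u v : R := \sum_(i < n) u i 0 * v i 0.

Lemma vdotC u v : vdot u v = vdot v u.
Proof. by apply: eq_bigr => i _; rewrite mulrC. Qed.

Lemma vdotDl u v w : vdot (u + v) w = vdot u w + vdot v w.
Proof. by rewrite -big_split; apply: eq_bigr => i _; rewrite mxE mulrDl. Qed.

Lemma vdotZl a u v : vdot (a *: u) v = a * vdot u v.
Proof. by rewrite /vdot big_distrr /=; apply: eq_bigr => i _; rewrite mxE -mulrA. Qed.

Lemma vdotNl u v : vdot (- u) v = - vdot u v.
Proof. by rewrite -scaleN1r vdotZl mulN1r. Qed.

Lemma vdot0l v : vdot 0 v = 0.
Proof. by rewrite -(scale0r 0) vdotZl mul0r. Qed.

Lemma vdotDr u v w : vdot u (v + w) = vdot u v + vdot u w.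
Proof. by rewrite vdotC vdotDl !(vdotC u). Qed.

Lemma vdotZr a u v : vdot u (a *: v) = a * vdot u v.
Proof. by rewrite vdotC vdotZl (vdotC u). Qed.

Lemma vdotNr u v : vdot u (- v) = - vdot u v.
Proof. by rewrite vdotC vdotNl (vdotC u). Qed.

Lemma vdot0r u : vdot u 0 = 0.
Proof. by rewrite vdotC vdot0l. Qed.

Definition vdotE := (vdotDl, vdotDr, vdotNl, vdotNr, vdotZl, vdotZr).

Lemma vdot_suml (k : nat) (F : nat -> 'cV[R]_n) v :
  vdot (\sum_(i < k) F i) v = \sum_(i < k) vdot (F i) v.
Proof.
elim: k => [|k IH]; first by rewrite !big_ord0 vdot0l.
by rewrite !big_ord_recr /= vdotDl IH.
Qed.

Lemma vdot_sumr (k : nat) (F : nat -> 'cV[R]_n) v :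
  vdot v (\sum_(i < k) F i) = \sum_(i < k) vdot v (F i).
Proof. by rewrite vdotC vdot_suml; apply: eq_bigr => i _; rewrite vdotC. Qed.

Lemma vdot_mxl (p : nat) (B : 'M[R]_(n, p)) u (v : 'cV[R]_p) :
  vdot u (B *m v) = \sum_(j < p) (B^T *m u) j 0 * v j 0.
Proof.
rewrite /vdot.
under eq_bigr do rewrite mxE big_distrr /=.
rewrite exchange_big /=; apply: eq_bigr => j _.
rewrite !mxE big_distrl /=; apply: eq_bigr => i _.
by rewrite !mxE mulrA (mulrC (u i 0)).
Qed.

Lemma vdot_ge0 u : 0 <= vdot u u.
Proof. by apply: sumr_ge0 => i _; rewrite -expr2 sqr_ge0. Qed.

Lemma enorm_ge0 u : 0 <= enorm u.
Proof. exact: sqrtr_ge0. Qed.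

Lemma enorm_sq u : enorm u ^+ 2 = vdot u u.
Proof.
rewrite sqr_sqrtr; first by apply: eq_bigr => i _; rewrite expr2.
by apply: sumr_ge0 => i _; rewrite sqr_ge0.
Qed.

Lemma enorm0 : enorm (0 : 'cV[R]_n) = 0.
Proof. by apply/eqP; rewrite -sqrf_eq0 enorm_sq vdot0l. Qed.

Lemma enormZ a u : enorm (a *: u) = `|a| * enorm u.
Proof.
apply/eqP; rewrite -(@eqrXn2 _ 2) ?mulr_ge0 ?enorm_ge0 ?normr_ge0 //.
by rewrite exprMn !enorm_sq !vdotE real_normK ?num_real // expr2 mulrA.
Qed.

Lemma enormN u : enorm (- u) = enorm u.
Proof. by rewrite -scaleN1r enormZ normrN1 mul1r. Qed.

Lemma enormB u v : enorm (u - v) = enorm (v - u).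
Proof. by rewrite -opprB enormN. Qed.

Lemma ler_enorm u v : vdot u u <= vdot v v -> enorm u <= enorm v.
Proof.
by rewrite -!enorm_sq => h; rewrite -(@ler_pXn2r _ 2) ?nnegrE ?enorm_ge0.
Qed.

Lemma enorm_le_sq a u : 0 <= a -> vdot u u <= a ^+ 2 -> enorm u <= a.
Proof.
by rewrite -enorm_sq => a0 h; rewrite -(@ler_pXn2r _ 2) ?nnegrE ?enorm_ge0.
Qed.

Lemma vdot_eq0 u : (vdot u u == 0) = (u == 0).
Proof.
apply/idP/eqP => [|->]; last by rewrite vdot0l.
rewrite psumr_eq0 => [/allP u0|i _]; last by rewrite -expr2 sqr_ge0.
apply/colP => i; rewrite mxE; have := u0 i (mem_index_enum _).
by rewrite /= -expr2 sqrf_eq0 => /eqP.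
Qed.

Lemma enorm_eq0 u : (enorm u == 0) = (u == 0).
Proof. by rewrite -sqrf_eq0 enorm_sq vdot_eq0. Qed.

Lemma cauchy_schwarz u v : `|vdot u v| <= enorm u * enorm v.
Proof.
have [->|v0] := eqVneq v 0; first by rewrite vdot0r normr0 enorm0 mulr0.
rewrite -(@ler_pXn2r _ 2) ?nnegrE ?normr_ge0 ?mulr_ge0 ?enorm_ge0 //.
rewrite exprMn !enorm_sq real_normK ?num_real //.
have vv : 0 < vdot v v by rewrite lt_neqAle vdot_ge0 eq_sym vdot_eq0 v0.
have := vdot_ge0 (vdot v v *: u - vdot u v *: v).
rewrite !vdotE (vdotC v u).
set a := vdot u u; set b := vdot u v; set c := vdot v v in vv * => h.
have {}h : 0 <= c * (a * c - b ^+ 2) by nra.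
by move: h; rewrite pmulr_rge0 // subr_ge0.
Qed.

Lemma vdot_le u v : vdot u v <= enorm u * enorm v.
Proof. exact: le_trans (ler_norm _) (cauchy_schwarz u v). Qed.

Lemma enormD u v : enorm (u + v) <= enorm u + enorm v.
Proof.
apply: enorm_le_sq; first by rewrite addr_ge0 ?enorm_ge0.
have := vdot_le u v; rewrite !vdotE (vdotC v u) sqrrD !enorm_sq; lra.
Qed.

Lemma enormBD u v : enorm (u - v) <= enorm u + enorm v.
Proof. by rewrite -(enormN v) enormD. Qed.

Lemma enorm_sum (k : nat) (F : nat -> 'cV[R]_n) :
  enorm (\sum_(i < k) F i) <= \sum_(i < k) enorm (F i).
Proof.
elim: k => [|k IH]; first by rewrite !big_ord0 enorm0.
by rewrite !big_ord_recr /=; apply: le_trans (enormD _ _) _; rewrite lerD2r.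
Qed.

Lemma coord_le_enorm u i : `|u i 0| <= enorm u.
Proof.
rewrite -(@ler_pXn2r _ 2) ?nnegrE ?enorm_ge0 // real_normK ?num_real //.
rewrite enorm_sq /vdot (bigD1 i) //= -expr2 lerDl.
by apply: sumr_ge0 => j _; rewrite -expr2 sqr_ge0.
Qed.

Lemma enorm_le_mxnorm u : enorm u <= n%:R * `|u|.
Proof.
have h : enorm u <= \sum_(i < n) `|u i 0|.
  apply: enorm_le_sq; first by apply: sumr_ge0.
  rewrite /vdot expr2 big_distrl /=; apply: ler_sum => i _.
  apply: le_trans (ler_norm _) _; rewrite normrM ler_wpM2l //.
  by rewrite (bigD1 i) //= lerDl sumr_ge0.
apply: le_trans h _.
have -> : n%:R * `|u| = \sum_(i < n) `|u|.
  by rewrite sumr_const card_ord mulr_natl.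
apply: ler_sum => i _.
have /mapP[j Hj ->] : `|u i 0| \in [seq `|u x.1 x.2| | x : 'I_n * 'I_1].
  by apply/mapP; exists (i, 0) => //=; rewrite mem_enum.
by rewrite [leRHS]/Num.norm /= mx_normrE; apply/bigmax_geP; right => /=; exists j.
Qed.

End EuclideanGeometry.

(** * Extreme eigenvalues and the condition number *)

Lemma quad_form_continuous (R : realType) (p : nat) (B : 'M[R]_p) :
  continuous (fun v : 'rV[R]_p => vdot v^T (B *m v^T)).
Proof.
have add_cont : continuous (fun x : R * R => x.1 + x.2) by exact: add_continuous.
have -> : (fun v : 'rV[R]_p => vdot v^T (B *m v^T)) =
          (fun v => \sum_(i < p) \sum_(j < p) v 0 i * (B i j * v 0 j)).
  apply/funext => v; rewrite /vdot; apply: eq_bigr => i _.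
  rewrite !mxE big_distrr /=; apply: eq_bigr => j _.
  by rewrite !mxE.
apply: (continuous_big add_cont) => i _.
apply: (continuous_big add_cont) => j _ v.
apply: (@continuousM _ _ (fun v : 'rV[R]_p => v 0 i)).
  exact: (@coord_continuous R 1 p 0 i v).
apply: (@continuousM _ _ (cst (B i j)) (fun v : 'rV[R]_p => v 0 j)).
  exact: cst_continuous.
exact: (@coord_continuous R 1 p 0 j v).
Qed.

(** The quadratic form of B attains its minimum lam on the unit sphere at some v.
    Then B - lam is positive semidefinite and its form vanishes at v, so v lies in
    its kernel: otherwise moving v along w = (B - lam) v would make the form
    negative. *)
Lemma rayleigh_min (R : realType) (p : nat) (B : 'M[R]_p) :
  (0 < p)%N -> B^T = B ->
  exists (lam : R) (v : 'cV[R]_p),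
    [/\ vdot v v = 1, B *m v = lam *: v &
        forall w, lam * vdot w w <= vdot w (B *m w)].
Proof.
case: p B => // p B _ symB.
pose S : set 'rV[R]_p.+1 := [set v | vdot v^T (1%:M *m v^T) = 1].
have S0 : S !=set0.
  exists (delta_mx 0 0); rewrite /S /= mul1mx /vdot big_ord_recl big1 => [|i _].
    by rewrite !mxE /= mulr1 addr0.
  by rewrite !mxE /= mulr0.
have cS : compact S.
  apply: bounded_closed_compact.
    exists 1; split => // M M1 v; rewrite /S /= mul1mx => v1.
    apply: le_trans (ltW M1).
    rewrite /Num.norm /= mx_normrE; apply/bigmax_leP; split => // -[i j] _ /=.
    rewrite ord1; have := coord_le_enorm v^T j; rewrite mxE => /le_trans; apply.
    by apply: enorm_le_sq => //; rewrite v1 expr1n.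
  rewrite (_ : S = (fun v : 'rV[R]_p.+1 => vdot v^T (1%:M *m v^T)) @^-1` [set 1]) //.
  apply: closed_comp => [v _|]; first exact: quad_form_continuous.
  exact: closed_eq.
have cq : {within S, continuous (fun v : 'rV[R]_p.+1 => vdot v^T (B *m v^T))}.
  by apply: continuous_subspaceT => v; exact: quad_form_continuous.
have [v0] := EVT_min_rV S0 cS cq.
rewrite inE /S /= mul1mx => v1 vmin.
set v := v0^T in v1 vmin; set lam := vdot v (B *m v) in vmin.
have lamP w : lam * vdot w w <= vdot w (B *m w).
  have [->|w0] := eqVneq w 0; first by rewrite !vdot0l mulr0.
  have ew : enorm w != 0 by rewrite enorm_eq0.
  have := vmin ((enorm w)^-1 *: w^T).
  rewrite inE /S /= !linearZ /= trmxK !mul1mx -?scalemxAr !vdotE -enorm_sq.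
  rewrite expr2 mulKf // mulVf // => /(_ erefl) h.
  have {}h := ler_wpM2l (sqr_ge0 (enorm w)) h.
  rewrite mulrC; apply: le_trans h _.
  rewrite expr2 -mulrA (mulrA (enorm w) (enorm w)^-1) divff // mul1r.
  by rewrite mulrA divff // mul1r.
exists lam, v; split => //.
have symv a b : vdot a (B *m b) = vdot b (B *m a).
  by rewrite vdot_mxl symB (vdotC b).
have : vdot (B *m v - lam *: v) (B *m v - lam *: v) = 0.
  have [w wE] : exists w, w = B *m v - lam *: v by eexists.
  rewrite -wE.
  have hw : vdot w v * lam = vdot w (B *m v) - vdot w w.
    by rewrite [in vdot w w]wE !(vdotDr, vdotNr, vdotZr) -wE; ring.
  pose q := vdot w (B *m w) - lam * vdot w w.
  have key t : 0 <= t ^+ 2 * q + 2 * t * vdot w w.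
    have := lamP (v + t *: w).
    rewrite mulmxDr -scalemxAr !vdotE v1 -/lam (symv v w) (vdotC v w) /q.
    move: hw; set a := vdot w v; set b := vdot w (B *m v).
    set c := vdot w w; set d := vdot w (B *m w) => hw h.
    have -> : c = b - a * lam by rewrite hw; ring.
    move: h; rewrite !expr2.
    nra.
  apply/eqP; apply/negPn/negP => w0.
  have wp : 0 < vdot w w by rewrite lt_neqAle vdot_ge0 eq_sym w0.
  have q0 : 0 < `|q| + 1 by rewrite ltr_wpDl.
  have := key (- (vdot w w / (`|q| + 1))).
  set c := vdot w w in wp *; set s := c / (`|q| + 1).
  have sp : 0 < s by rewrite divr_gt0.
  have sE : s * (`|q| + 1) = c by rewrite divfK // gt_eqF.
  have := ler_norm q; set z := `|q| in q0 sE * => qz.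
  move=> h; have : s ^+ 2 * q <= s ^+ 2 * z by rewrite ler_wpM2l // sqr_ge0.
  rewrite sqrrN in h; nra.
by move=> /eqP; rewrite vdot_eq0 subr_eq0 => /eqP.
Qed.

Lemma mulmx_bounded (R : realType) (n p : nat) (A : 'M[R]_(n, p)) :
  exists2 K : R, 0 <= K & forall v : 'cV[R]_p, enorm (A *m v) <= K * enorm v.
Proof.
exists (Num.sqrt (\sum_(i < n) enorm (row i A)^T ^+ 2)) => [|v].
  exact: sqrtr_ge0.
apply: enorm_le_sq; first by rewrite mulr_ge0 ?sqrtr_ge0 ?enorm_ge0.
rewrite exprMn sqr_sqrtr; last by apply: sumr_ge0 => i _; rewrite sqr_ge0.
rewrite big_distrl /=; apply: ler_sum => i _.
rewrite -expr2 -exprMn -[leLHS]real_normK ?num_real //.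
rewrite lerXn2r ?nnegrE ?mulr_ge0 ?enorm_ge0 ?normr_ge0 //.
apply: le_trans (cauchy_schwarz _ _); rewrite /vdot mxE.
by under [in leRHS]eq_bigr do rewrite !mxE.
Qed.

Lemma spectral_norm_le (R : realType) (n p : nat) (A : 'M[R]_(n, p)) v :
  enorm (A *m v) <= spectral_norm A * enorm v.
Proof.
have [->|v0] := eqVneq v 0; first by rewrite mulmx0 !enorm0 mulr0.
have nzv : enorm v != 0 by rewrite enorm_eq0.
have ev0 : 0 < enorm v by rewrite lt_neqAle eq_sym nzv enorm_ge0.
rewrite -ler_pdivrMr //; apply: ub_le_sup.
  have [K K0 hK] := mulmx_bounded A.
  exists K => _ [w /= w1 <-]; apply: le_trans (hK w) _.
  by rewrite ler_piMr.
exists ((enorm v)^-1 *: v) => /=; last first.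
  by rewrite -scalemxAr enormZ gtr0_norm ?invr_gt0 // mulrC.
by rewrite enormZ gtr0_norm ?invr_gt0 // mulVf.
Qed.

Lemma eigen_singular (R : realType) (p : nat) (B : 'M[R]_p) (lam : R)
    (v : 'cV[R]_p) :
  B^T = B -> 0 <= lam -> v != 0 -> B *m v = lam *: v ->
  singular_values B lam.
Proof.
move=> symB lam0 v0 Bv; exists (lam ^+ 2); last by rewrite sqrtr_sqr ger0_norm.
apply/eigenvalueP; exists v^T; last by rewrite trmx_eq0.
have vB : v^T *m B = lam *: v^T by rewrite -[in LHS]symB -trmx_mul Bv linearZ.
by rewrite symB mulmxA vB -scalemxAl vB scalerA expr2.
Qed.

(** This makes the supremum defining [sigma_max] a genuine one. *)
Lemma singular_values_ubound (R : realType) (p : nat) (B : 'M[R]_p) :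
  has_ubound (singular_values B).
Proof.
have [K K0 hK] := mulmx_bounded B.
exists K => _ [a /eigenvalueP[v va v0] <-].
have e0 : 0 < enorm v^T.
  by rewrite lt_neqAle enorm_ge0 eq_sym enorm_eq0 trmx_eq0 v0.
have h : a * enorm v^T ^+ 2 = enorm (B *m v^T) ^+ 2.
  have vva : v *m (B^T *m B) *m v^T = a *: (v *m v^T) by rewrite va scalemxAl.
  have := congr1 (fun N : 'M[R]_(1, 1) => N 0 0) vva.
  rewrite !enorm_sq mxE => H.
  have -> : vdot v^T v^T = (v *m v^T) 0 0.
    by rewrite mxE; apply: eq_bigr => i _; rewrite !mxE.
  have -> : vdot (B *m v^T) (B *m v^T) = (v *m (B^T *m B) *m v^T) 0 0.
    have -> : v *m (B^T *m B) *m v^T = (B *m v^T)^T *m (B *m v^T).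
      by rewrite trmx_mul trmxK !mulmxA.
    by rewrite [in RHS]mxE; apply: eq_bigr => i _; rewrite !mxE.
  by rewrite vva !mxE.
have aK : a <= K ^+ 2.
  rewrite -(@ler_pM2r _ (enorm v^T ^+ 2)) ?exprn_gt0 // h -exprMn.
  by rewrite lerXn2r ?nnegrE ?mulr_ge0 ?enorm_ge0.
by apply: le_trans (ler_wsqrtr aK) _; rewrite sqrtr_sqr ger0_norm.
Qed.

(** The form in which the condition number is used: X stretches any two vectors by
    factors within M of each other.  The smallest and largest eigenvalues of the
    Gram matrix are among its singular values, so they enclose its Rayleigh
    quotients between [sigma_min] and [sigma_max]. *)
Lemma cond_number_gram (R : realType) (n p : nat) (X : 'M[R]_(n, p)) (M : R) :
  (0 < p)%N -> 0 <= M ->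
  (cond_number (X^T *m X) <= (M ^+ 2)%:E)%E ->
  forall v w : 'cV[R]_p, w != 0 ->
    0 < enorm (X *m w) /\
    enorm (X *m v) * enorm w <= M * enorm (X *m w) * enorm v.
Proof.
move=> p0 M0; set B := X^T *m X.
have symB : B^T = B by rewrite trmx_mul trmxK.
have BX v : vdot v (B *m v) = enorm (X *m v) ^+ 2.
  by rewrite enorm_sq -mulmxA vdot_mxl trmxK.
have [lam [v0 [v01 Bv0 lamP]]] := rayleigh_min p0 symB.
have symNB : (- B)^T = - B by rewrite linearN /= symB.
have [Lam [v1 [v11 Bv1 LamP]]] := rayleigh_min p0 symNB.
have nz (v : 'cV[R]_p) : vdot v v = 1 -> v != 0.
  by move=> h; rewrite -vdot_eq0 h oner_eq0.
have lam0 : 0 <= lam.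
  have := BX v0; rewrite Bv0 vdotZr v01 mulr1 => ->; exact: sqr_ge0.
have Bv1' : B *m v1 = (- Lam) *: v1.
  by rewrite scaleNr -Bv1 mulNmx opprK.
have Lam0 : 0 <= - Lam.
  have := BX v1; rewrite Bv1' vdotZr v11 mulr1 => ->; exact: sqr_ge0.
have s_lam := eigen_singular symB lam0 (nz _ v01) Bv0.
have s_Lam := eigen_singular symB Lam0 (nz _ v11) Bv1'.
have lb0 : lbound (singular_values B) 0 by move=> _ [a _ <-]; exact: sqrtr_ge0.
have minlam : sigma_min B <= lam by apply: ge_inf => //; exists 0.
have min0 : 0 <= sigma_min B by apply: lb_le_inf => //; exists lam.
have maxLam : - Lam <= sigma_max B.
  by apply: ub_le_sup => //; exact: singular_values_ubound.
rewrite /cond_number; case: eqP => [_|/eqP smin0]; first by rewrite leye_eq.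
have sp : 0 < sigma_min B by rewrite lt_neqAle eq_sym smin0.
rewrite lee_fin ler_pdivrMr // => hM v w w0.
have ew : 0 < enorm w by rewrite lt_neqAle eq_sym enorm_eq0 w0 enorm_ge0.
have hw : sigma_min B * enorm w ^+ 2 <= enorm (X *m w) ^+ 2.
  by rewrite -BX; apply: le_trans (lamP w); rewrite enorm_sq ler_wpM2r ?vdot_ge0.
have hv : enorm (X *m v) ^+ 2 <= sigma_max B * enorm v ^+ 2.
  rewrite -BX; apply: (@le_trans _ _ (- Lam * vdot v v)).
    by have := LamP v; rewrite mulNmx vdotNr; lra.
  by rewrite enorm_sq ler_wpM2r ?vdot_ge0.
split.
  rewrite lt_neqAle enorm_ge0 andbT eq_sym -sqrf_eq0 gt_eqF //.
  by apply: lt_le_trans hw; rewrite mulr_gt0 // exprn_gt0.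
rewrite -(@ler_pXn2r _ 2) ?nnegrE ?mulr_ge0 ?enorm_ge0 //.
rewrite !exprMn.
have := enorm_ge0 v; have := sqr_ge0 (enorm v).
set a := enorm v ^+ 2 in hv *; set b := enorm w ^+ 2 in hw *.
set c := enorm (X *m v) ^+ 2 in hv *; set d := enorm (X *m w) ^+ 2 in hw *.
move=> a0 _; have b0 : 0 <= b by exact: sqr_ge0.
apply: (@le_trans _ _ (sigma_max B * a * b)); first by rewrite ler_wpM2r.
apply: (@le_trans _ _ (M ^+ 2 * sigma_min B * a * b)).
  by rewrite !ler_wpM2r.
have -> : M ^+ 2 * sigma_min B * a * b = M ^+ 2 * a * (sigma_min B * b) by ring.
by rewrite mulrAC ler_wpM2l // mulr_ge0 // sqr_ge0.
Qed.

(** * Bounds of order e^k on a family with scale e *)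

Section Asymptotics.
Variables (R : realType) (T : Type) (e : T -> R).
Hypothesis e_gt0 : forall t, 0 < e t.
Implicit Types (F G : T -> R) (k l : nat).

Definition for_small (P : T -> Prop) := exists2 d, 0 < d & forall t, e t <= d -> P t.

Lemma for_small_and P Q : for_small P -> for_small Q -> for_small (fun t => P t /\ Q t).
Proof.
move=> [d d0 hP] [d' d'0 hQ]; exists (Num.min d d'); first by rewrite lt_min d0.
by move=> t; rewrite le_min => /andP[? ?]; split; [exact: hP|exact: hQ].
Qed.

Lemma for_small_mono (P Q : T -> Prop) :
  (forall t, P t -> Q t) -> for_small P -> for_small Q.
Proof. by move=> PQ [d d0 hP]; exists d => // t /hP/PQ. Qed.

Lemma for_small_le (c : R) : 0 < c -> for_small (fun t => e t <= c).
Proof. by move=> c0; exists c. Qed.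

Lemma for_small_and_mono (P Q S : T -> Prop) :
  (forall t, P t -> Q t -> S t) -> for_small P -> for_small Q -> for_small S.
Proof.
move=> h hP hQ; apply: for_small_mono (for_small_and hP hQ) => t [].
exact: h.
Qed.

(** The constant is uniform over the family, and the bound is only required where
    the scale e is small; the threshold may differ from one estimate to the
    next. *)
Definition isO k F := exists2 C, 0 <= C & for_small (fun t => `|F t| <= C * e t ^+ k).

(** One-sided version, the form in which approximate inequalities are
    propagated. *)
Definition Oge k F := exists2 C, 0 <= C & for_small (fun t => - (C * e t ^+ k) <= F t).

Let ek k t : 0 <= e t ^+ k. Proof. by rewrite exprn_ge0 // ltW. Qed.

Lemma isO_ext k F G : (forall t, F t = G t) -> isO k F -> isO k G.
Proof. by move=> /funext->. Qed.

Lemma isO_cst (c : R) : isO 0 (fun=> c).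
Proof. by exists `|c| => //; exists 1 => // t _; rewrite expr0 mulr1. Qed.

Lemma isO0 k : isO k (fun=> 0).
Proof. by exists 0 => //; exists 1 => // t _; rewrite normr0 mul0r. Qed.

Let powle k l t : (l <= k)%N -> e t <= 1 -> e t ^+ k <= e t ^+ l.
Proof. by move=> lk e1; apply: ler_wiXn2l => //; exact: ltW. Qed.

Lemma isO_weak k l F : (l <= k)%N -> isO k F -> isO l F.
Proof.
move=> lk [C C0 hF]; exists C => //.
apply: (for_small_and_mono _ hF (for_small_le ltr01)) => t h e1.
by apply: le_trans h _; rewrite ler_wpM2l // powle.
Qed.

Lemma isO_le k F G : for_small (fun t => `|F t| <= `|G t|) -> isO k G -> isO k F.
Proof.
move=> h [C C0 hG]; exists C => //.
by apply: (for_small_and_mono _ h hG) => t; exact: le_trans.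
Qed.

Lemma isOD k F G : isO k F -> isO k G -> isO k (fun t => F t + G t).
Proof.
move=> [C C0 hF] [D D0 hG]; exists (C + D); first exact: addr_ge0.
apply: (for_small_and_mono _ hF hG) => t h1 h2.
by rewrite mulrDl (le_trans (ler_normD _ _)) // lerD.
Qed.

Lemma isON k F : isO k F -> isO k (fun t => - F t).
Proof.
by move=> [C C0 hF]; exists C => //; apply: for_small_mono hF => t; rewrite normrN.
Qed.

Lemma isOB k F G : isO k F -> isO k G -> isO k (fun t => F t - G t).
Proof. by move=> hF hG; apply: isOD => //; exact: isON. Qed.

Lemma isOM k l F G : isO k F -> isO l G -> isO (k + l) (fun t => F t * G t).
Proof.
move=> [C C0 hF] [D D0 hG]; exists (C * D); first exact: mulr_ge0.
apply: (for_small_and_mono _ hF hG) => t h1 h2.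
by rewrite exprD normrM mulrACA ler_pM.
Qed.

Lemma isO_sum k l (F : nat -> T -> R) :
  (forall i, (i < l)%N -> isO k (F i)) -> isO k (fun t => \sum_(i < l) F i t).
Proof.
elim: l => [|l IH] h.
  by apply: isO_ext (isO0 k) => t; rewrite big_ord0.
apply: (@isO_ext _ (fun t => \sum_(i < l) F i t + F l t)).
  by move=> t; rewrite big_ord_recr.
by apply: isOD; [apply: IH => i il; apply: h; exact: ltnW|exact: h].
Qed.

Lemma isO_div k l F G (c : R) :
  isO (k + l) F -> 0 < c -> for_small (fun t => c * e t ^+ l <= G t) ->
  isO k (fun t => F t / G t).
Proof.
move=> [C C0 hF] c0 hG; exists (C / c); first by rewrite divr_ge0 // ltW.
apply: (for_small_and_mono _ hF hG) => t h1 h2.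
have el : 0 < e t ^+ l by rewrite exprn_gt0.
have G0 : 0 < G t by apply: lt_le_trans h2; rewrite mulr_gt0.
rewrite normrM normfV (gtr0_norm G0) ler_pdivrMr //; apply: le_trans h1 _.
have -> : C * e t ^+ (k + l) = C / c * e t ^+ k * (c * e t ^+ l).
  by rewrite exprD; field; rewrite gt_eqF.
by rewrite ler_wpM2l // mulr_ge0 // divr_ge0 // ltW.
Qed.

Lemma isO_Oge k F : isO k F -> Oge k F.
Proof.
move=> [C C0 hF]; exists C => //; apply: for_small_mono hF => t.
by rewrite ler_norml => /andP[].
Qed.

Lemma Oge_ge0 k F : (forall t, 0 <= F t) -> Oge k F.
Proof.
by move=> F0; exists 0 => //; exists 1 => // t _; rewrite mul0r oppr0.
Qed.

Lemma Oge_mono k F G : Oge k F -> (forall t, F t <= G t) -> Oge k G.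
Proof.
move=> [C C0 hF] FG; exists C => //; apply: for_small_mono hF => t h.
exact: le_trans h (FG t).
Qed.

Lemma OgeD k F G : Oge k F -> Oge k G -> Oge k (fun t => F t + G t).
Proof.
move=> [C C0 hF] [D D0 hG]; exists (C + D); first exact: addr_ge0.
by apply: (for_small_and_mono _ hF hG) => t h1 h2; rewrite mulrDl opprD lerD.
Qed.

Lemma Oge_isO k F G : Oge k F -> isO k (fun t => G t - F t) -> Oge k G.
Proof.
move=> hF /isO_Oge hG; apply: Oge_mono (OgeD hF hG) _ => t.
by rewrite addrC subrK.
Qed.

Lemma Oge_sum k l (F : nat -> T -> R) :
  (forall i, (i < l)%N -> Oge k (F i)) -> Oge k (fun t => \sum_(i < l) F i t).
Proof.
elim: l => [|l IH] h.
  by apply: Oge_ge0 => t; rewrite big_ord0.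
apply: (@Oge_mono _ (fun t => \sum_(i < l) F i t + F l t)); last first.
  by move=> t; rewrite big_ord_recr.
by apply: OgeD; [apply: IH => i il; apply: h; exact: ltnW|exact: h].
Qed.

Lemma Oge_div k l F G (c : R) :
  Oge (k + l) F -> 0 < c -> for_small (fun t => c * e t ^+ l <= G t) ->
  Oge k (fun t => F t / G t).
Proof.
move=> [C C0 hF] c0 hG; exists (C / c); first by rewrite divr_ge0 // ltW.
apply: (for_small_and_mono _ hF hG) => t h1 h2.
have el : 0 < e t ^+ l by rewrite exprn_gt0.
have G0 : 0 < G t by apply: lt_le_trans h2; rewrite mulr_gt0.
rewrite ler_pdivlMr //; apply: le_trans h1; rewrite mulNr lerN2.
have -> : C * e t ^+ (k + l) = C / c * e t ^+ k * (c * e t ^+ l).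
  by rewrite exprD; field; rewrite gt_eqF.
by rewrite ler_wpM2l // mulr_ge0 // divr_ge0 // ltW.
Qed.

(** The product of the two shifted, nonnegative factors F + C e^k and G + D e^l
    is nonnegative; what remains after expanding it is controlled by the
    one-sided bound on one factor times the two-sided bound on the other. *)
Lemma OgeM j k k' l l' F G : (j <= k + l')%N -> (j <= k' + l)%N ->
  (j <= k + l)%N ->
  Oge k F -> isO k' F -> Oge l G -> isO l' G -> Oge j (fun t => F t * G t).
Proof.
move=> j1 j2 j3 [C C0 hF] oF [D D0 hG] oG.
have eO i : isO i (fun t => e t ^+ i).
  by exists 1 => //; exists 1 => // t _; rewrite mul1r ger0_norm.
pose H t := - (C * (e t ^+ k * G t) + D * (F t * e t ^+ l)
                + C * D * (e t ^+ k * e t ^+ l)).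
have hH : Oge j H.
  apply/isO_Oge/isON; apply: isOD; first apply: isOD.
  - apply: (@isO_weak (0 + (k + l'))) => //.
    by apply: isOM; [exact: isO_cst|exact: isOM].
  - apply: (@isO_weak (0 + (k' + l))) => //.
    by apply: isOM; [exact: isO_cst|exact: isOM].
  - apply: (@isO_weak (0 + (k + l))) => //.
    by apply: isOM; [exact: isO_cst|exact: isOM].
case: hH => B B0 hH; exists B => //.
apply: (for_small_and_mono _ hH (for_small_and hF hG)) => t h [h1 h2].
apply: le_trans h _; rewrite /H.
have := ek k t; have := ek l t.
have p1 : 0 <= F t + C * e t ^+ k by lra.
have p2 : 0 <= G t + D * e t ^+ l by lra.
have := mulr_ge0 p1 p2; nra.
Qed.

Lemma Oge_forall j k (F : nat -> T -> R) :
  (forall i, (i < k)%N -> Oge j (F i)) ->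
  exists2 C, 0 <= C &
    for_small (fun t => forall i, (i < k)%N -> - (C * e t ^+ j) <= F i t).
Proof.
elim: k => [|k IH] hF; first by exists 0 => //; exists 1.
have [C C0 hC] := IH (fun i ik => hF i (ltnW ik)).
have [D D0 hD] := hF k (ltnSn k).
exists (C + D); first exact: addr_ge0.
apply: (for_small_and_mono _ hC hD) => t h1 h2 i.
have ej : 0 <= e t ^+ j by rewrite exprn_ge0 // ltW.
rewrite ltnS leq_eqVlt => /orP[/eqP->|ik].
  by apply: le_trans h2; rewrite lerN2 ler_wpM2r // lerDr.
by apply: le_trans (h1 i ik); rewrite lerN2 ler_wpM2r // lerDl.
Qed.

Section Vectors.
Variable n : nat.
Implicit Types (V W : T -> 'cV[R]_n).

Definition vO k V := isO k (fun t => enorm (V t)).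

Lemma vO_ext k V W : (forall t, V t = W t) -> vO k V -> vO k W.
Proof. by move=> /funext->. Qed.

Lemma vO_weak k l V : (l <= k)%N -> vO k V -> vO l V.
Proof. exact: isO_weak. Qed.

Lemma vO0 k : vO k (fun=> 0).
Proof. by rewrite /vO; under eq_fun do rewrite enorm0; exact: isO0. Qed.

Lemma vOD k V W : vO k V -> vO k W -> vO k (fun t => V t + W t).
Proof.
move=> hV hW; apply: isO_le (isOD hV hW); exists 1 => // t _.
by rewrite !ger0_norm ?addr_ge0 ?enorm_ge0 // enormD.
Qed.

Lemma vON k V : vO k V -> vO k (fun t => - V t).
Proof. by rewrite /vO; under eq_fun do rewrite -enormN. Qed.

Lemma vOB k V W : vO k V -> vO k W -> vO k (fun t => V t - W t).
Proof. by move=> hV hW; apply: vOD => //; exact: vON. Qed.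

Lemma vOZ k l F V : isO k F -> vO l V -> vO (k + l) (fun t => F t *: V t).
Proof.
move=> hF hV; apply: isO_le (isOM hF hV); exists 1 => // t _.
by rewrite enormZ !normrM normr_id.
Qed.

Lemma vO_sum k l (V : nat -> T -> 'cV[R]_n) :
  (forall i, (i < l)%N -> vO k (V i)) -> vO k (fun t => \sum_(i < l) V i t).
Proof.
elim: l => [|l IH] h.
  by apply: vO_ext (vO0 k) => t; rewrite big_ord0.
apply: (@vO_ext _ (fun t => \sum_(i < l) V i t + V l t)).
  by move=> t; rewrite big_ord_recr.
by apply: vOD; [apply: IH => i il; apply: h; exact: ltnW|exact: h].
Qed.

Lemma vO_mx k V (B : 'M[R]_n) : vO k V -> vO k (fun t => B *m V t).
Proof.
move=> hV; have [K K0 hK] := mulmx_bounded B.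
apply: (@isO_le _ _ (fun t => K * enorm (V t))).
  exists 1 => // t _.
  by rewrite !ger0_norm ?mulr_ge0 ?enorm_ge0 //.
by apply: (@isOM 0) => //; exact: isO_cst.
Qed.

Lemma vO_dot k l V W : vO k V -> vO l W -> isO (k + l) (fun t => vdot (V t) (W t)).
Proof.
move=> hV hW; apply: isO_le (isOM hV hW); exists 1 => // t _.
by rewrite normrM !(ger0_norm (enorm_ge0 _)) cauchy_schwarz.
Qed.

End Vectors.
End Asymptotics.

(** * Approximate Krylov recurrences *)

Section LinearCombinations.
Variables (R : realType) (n : nat).

Definition lincomb (k : nat) (c : nat -> R) (v : nat -> 'cV[R]_n) : 'cV[R]_n :=
  \sum_(i < k) c i *: v i.

Lemma vdot_lincomb k c v (u : 'cV[R]_n) :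
  vdot u (lincomb k c v) = \sum_(i < k) c i * vdot u (v i).
Proof.
rewrite /lincomb (vdot_sumr k (fun i => c i *: v i)).
by apply: eq_bigr => i _; rewrite vdotZr.
Qed.

Lemma mulmx_lincomb (A : 'M[R]_n) k c v :
  A *m lincomb k c v = lincomb k c (fun i => A *m v i).
Proof. by rewrite mulmx_sumr; apply: eq_bigr => i _; rewrite scalemxAr. Qed.

Lemma lincombS k c v : lincomb k.+1 c v = lincomb k c v + c k *: v k.
Proof. by rewrite /lincomb big_ord_recr. Qed.

Lemma lincomb_eq k c d v :
  (forall i, (i < k)%N -> c i = d i) -> lincomb k c v = lincomb k d v.
Proof. by move=> cd; apply: eq_bigr => i _; rewrite cd. Qed.

Lemma lincombD k c d v :
  lincomb k (fun i => c i + d i) v = lincomb k c v + lincomb k d v.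
Proof. by rewrite -big_split; apply: eq_bigr => i _; rewrite scalerDl. Qed.

Lemma lincombZ k a c v : lincomb k (fun i => a * c i) v = a *: lincomb k c v.
Proof. by rewrite scaler_sumr; apply: eq_bigr => i _; rewrite scalerA. Qed.

Lemma lincomb_widen k l c v : (k <= l)%N ->
  lincomb l (fun i => if (i < k)%N then c i else 0) v = lincomb k c v.
Proof.
move=> /subnKC <-; elim: (l - k)%N => [|j IH].
  by rewrite addn0; apply: lincomb_eq => i ->.
by rewrite addnS lincombS IH ltnNge leq_addr /= scale0r addr0.
Qed.

End LinearCombinations.

(** The hypotheses describe a minimal residual iteration up to errors: s_j is a
    bounded combination of the increments s_i + r_i, the residual r_j is affine
    in s_j, and it is orthogonal to the A-images of the previous increments.  The
    lower bound on |r_j| excludes stagnation. *)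
Section ApproximateKrylov.
Variables (R : realType) (T : Type) (e : T -> R).
Hypothesis e_gt0 : forall t, 0 < e t.
Variables (n : nat) (A : 'M[R]_n) (c0 : R).
Hypothesis A_sym : forall u v, vdot u (A *m v) = vdot v (A *m u).
Hypothesis c0_gt0 : 0 < c0.
Hypothesis A_lb : forall u, c0 * vdot u u <= vdot u (A *m u).
Hypothesis A_ub : forall u, vdot u (A *m u) <= vdot u u.

Variables (m : nat) (r s : nat -> T -> 'cV[R]_n) (a : nat -> nat -> T -> R).
Hypothesis r_O : forall j, (j <= m)%N -> vO e 1 (r j).
Hypothesis a_O : forall j i, (i < j <= m)%N -> isO e 0 (a j i).
Hypothesis s_def : forall j t, (j <= m)%N ->
  s j t = lincomb j (fun i => a j i t) (fun i => s i t + r i t).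
Hypothesis r_affine : forall j, (j <= m)%N ->
  vO e 2 (fun t => r j t - (r 0%N t - A *m s j t)).
Hypothesis r_orth : forall i j, (i < j <= m)%N ->
  isO e 3 (fun t => vdot (r j t) (A *m (s i t + r i t))).
Variable c1 : R.
Hypothesis c1_gt0 : 0 < c1.
Hypothesis r_lb : forall j, (j < m)%N -> for_small e (fun t => c1 * e t <= enorm (r j t)).

(** The inequality A^2 <= A for 0 <= A <= I, from positivity of the form of A at
    u - A u. *)
Lemma mx_contract u : vdot (A *m u) (A *m u) <= vdot u (A *m u).
Proof.
have c0u v : 0 <= vdot v (A *m v).
  by apply: le_trans (A_lb v); rewrite mulr_ge0 ?vdot_ge0 // ltW.
have := c0u (u - A *m u); have := A_ub (A *m u).
rewrite mulmxBr !vdotE (A_sym u (A *m u)); lra.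
Qed.

Let eta j t := vdot (r j t) (r j t).
Let rho j t := vdot (r j t) (A *m r j t).

(** Membership in the span of r_0, ..., r_(k-1) with bounded coefficients, for
    vectors of size e that matter only modulo e^2. *)
Definition in_span k (V : T -> 'cV[R]_n) :=
  exists2 c : nat -> T -> R, (forall i, (i < k)%N -> isO e 0 (c i)) &
    vO e 2 (fun t => V t - lincomb k (fun i => c i t) (fun i => r i t)).

Lemma span_ext k V W : (forall t, V t = W t) -> in_span k V -> in_span k W.
Proof. by move=> /funext->. Qed.

Lemma spanD k V W : in_span k V -> in_span k W -> in_span k (fun t => V t + W t).
Proof.
move=> [c hc hV] [d hd hW]; exists (fun i t => c i t + d i t).
  by move=> i ik; apply: isOD => //; [exact: hc|exact: hd].
apply: vO_ext (vOD hV hW) => t.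
by rewrite lincombD opprD addrACA.
Qed.

Lemma spanZ k F V : isO e 0 F -> in_span k V -> in_span k (fun t => F t *: V t).
Proof.
move=> hF [c hc hV]; exists (fun i t => F t * c i t).
  by move=> i ik; apply: (@isOM _ _ _ 0 0) => //; exact: hc.
apply: vO_ext (vOZ hF hV : vO e 2 _) => t.
by rewrite lincombZ scalerBr.
Qed.

Lemma spanN k V : in_span k V -> in_span k (fun t => - V t).
Proof.
move=> hV; apply: span_ext (spanZ (isO_cst e (-1)) hV) => t.
by rewrite scaleN1r.
Qed.

Lemma span_err k V : vO e 2 V -> in_span k V.
Proof.
move=> hV; exists (fun _ _ => 0) => [i _|]; first exact: isO0.
apply: vO_ext hV => t.
by rewrite [lincomb _ _ _]big1 ?subr0 // => i _; rewrite scale0r.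
Qed.

Lemma span_widen k l V : (k <= l)%N -> in_span k V -> in_span l V.
Proof.
move=> kl [c hc hV]; exists (fun i t => if (i < k)%N then c i t else 0).
  by move=> i _; case: (ltnP i k) => [/hc //|_]; exact: isO0.
by apply: vO_ext hV => t; rewrite lincomb_widen.
Qed.

Lemma span_r k j : (j < k)%N -> in_span k (r j).
Proof.
move=> jk; apply: (span_widen jk).
exists (fun i _ => if i == j then 1 else 0) => [i _|].
  by case: (i == j); [exact: isO_cst|exact: isO0].
apply: vO_ext (vO0 e n 2) => t.
rewrite lincombS eqxx scale1r [lincomb _ _ _]big1 ?add0r ?subrr // => i _.
by rewrite ltn_eqF ?scale0r.
Qed.

Lemma span_lincomb k l (c : nat -> T -> R) (V : nat -> T -> 'cV[R]_n) :
  (forall i, (i < l)%N -> isO e 0 (c i)) ->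
  (forall i, (i < l)%N -> in_span k (V i)) ->
  in_span k (fun t => lincomb l (fun i => c i t) (fun i => V i t)).
Proof.
elim: l => [|l IH] hc hV.
  by apply: span_err; apply: vO_ext (vO0 e n 2) => t; rewrite /lincomb big_ord0.
apply: (@span_ext _ (fun t => lincomb l (fun i => c i t) (fun i => V i t)
                              + c l t *: V l t)).
  by move=> t; rewrite lincombS.
apply: spanD.
  by apply: IH => i il; [apply: hc|apply: hV]; exact: ltnW.
by apply: spanZ; [exact: hc|exact: hV].
Qed.

Lemma span_s j : (j <= m)%N -> in_span j (s j).
Proof.
elim/ltn_ind: j => j IH jm.
have /funext -> := fun t => s_def t jm.
apply: span_lincomb => i ij; first by apply: a_O; rewrite ij.
apply: spanD; last exact: span_r.
by apply: (span_widen (ltnW ij)); apply: IH => //; exact: leq_trans (ltnW ij) jm.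
Qed.

(** Each r_i is itself a combination of increments, since s_i is one; so the
    orthogonality to increments makes the residuals A-orthogonal. *)
Lemma r_Aorth i j : (i < j <= m)%N -> isO e 3 (fun t => vdot (r j t) (A *m r i t)).
Proof.
move=> /andP[ij jm].
have im : (i <= m)%N by exact: leq_trans (ltnW ij) jm.
apply: (@isO_ext _ _ _ _ (fun t =>
  vdot (r j t) (A *m (s i t + r i t)) -
  \sum_(l < i) a i l t * vdot (r j t) (A *m (s l t + r l t)))) => [t|].
  rewrite -(vdot_lincomb i (fun l => a i l t) (fun l => A *m (s l t + r l t))).
  rewrite -(mulmx_lincomb A i (fun l => a i l t) (fun l => s l t + r l t)).
  by rewrite -s_def // mulmxDr vdotDr addrAC subrr add0r.
apply: isOB; first by apply: r_orth; rewrite ij.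
apply: (@isO_sum _ _ _ _ _ (fun l t => a i l t * vdot (r j t) (A *m (s l t + r l t)))).
move=> l li; apply: (@isOM _ _ _ 0 3); first by apply: a_O; rewrite li.
by apply: r_orth; rewrite (ltn_trans li ij).
Qed.

Lemma r_span_orth j k V : (k <= j <= m)%N -> in_span k V ->
  isO e 3 (fun t => vdot (r j t) (A *m V t)).
Proof.
move=> /andP[kj jm] [c hc hV].
pose W t := lincomb k (fun i => c i t) (fun i => r i t).
apply: (@isO_ext _ _ _ _ (fun t =>
  vdot (r j t) (A *m (V t - W t)) +
  \sum_(i < k) c i t * vdot (r j t) (A *m r i t))) => [t|].
  rewrite -(vdot_lincomb k (fun i => c i t) (fun i => A *m r i t)).
  by rewrite -mulmx_lincomb -vdotDr -mulmxDr subrK.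
apply: isOD.
  by apply: (@vO_dot _ _ _ _ 1 2); [exact: r_O|exact: vO_mx].
apply: (@isO_sum _ _ _ _ _ (fun i t => c i t * vdot (r j t) (A *m r i t))).
move=> i ik; apply: (@isOM _ _ _ 0 3); first exact: hc.
by apply: r_Aorth; rewrite (leq_trans ik kj).
Qed.

Lemma r_diff i j : (i <= j <= m)%N ->
  vO e 2 (fun t => (r i t - r j t) - A *m (s j t - s i t)).
Proof.
move=> /andP[ij jm]; have im := leq_trans ij jm.
apply: vO_ext (vOB (r_affine im) (r_affine jm)) => t.
rewrite mulmxBr.
move: (A *m s j t) (A *m s i t) (r i t) (r j t) (r 0%N t) => p q x y z.
by apply/colP => l; rewrite !mxE; ring.
Qed.

Lemma span_step i j : (i <= j <= m)%N -> in_span j (fun t => s j t - s i t).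
Proof.
move=> /andP[ij jm]; apply: spanD; first exact: span_s.
by apply/spanN/(span_widen ij)/span_s; exact: leq_trans jm.
Qed.

(** The difference r_i - r_j is nearly A (s_j - s_i) with s_j - s_i in the span of
    the earlier residuals, hence nearly orthogonal to r_j. *)
Lemma r_gram i j : (i <= j <= m)%N ->
  isO e 3 (fun t => vdot (r j t) (r i t) - eta j t).
Proof.
move=> /[dup] ijm /andP[ij jm].
have h1 : isO e 3 (fun t => vdot (r j t) (A *m (s j t - s i t))).
  by apply: (r_span_orth _ (span_step ijm)); rewrite leqnn.
have h2 := @vO_dot _ _ _ _ 1 2 _ _ (r_O jm) (r_diff ijm).
apply: isO_ext (isOD h1 h2) => t.
by rewrite -vdotDr addrC subrK vdotDr vdotNr.
Qed.

Lemma rho_ub j t : rho j t <= eta j t. Proof. exact: A_ub. Qed.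

Lemma rho_ge0 j t : 0 <= rho j t.
Proof. by apply: le_trans (A_lb _); rewrite mulr_ge0 ?vdot_ge0 // ltW. Qed.

Lemma contract_sq u :
  vdot (u - A *m u) (u - A *m u) <= vdot u u - vdot u (A *m u).
Proof. by have := mx_contract u; rewrite !vdotE (vdotC (A *m u) u); lra. Qed.

Lemma rho_lb j : (j < m)%N -> for_small e (fun t => c0 * c1 ^+ 2 * e t ^+ 2 <= rho j t).
Proof.
move=> /r_lb; apply: for_small_mono => t h; apply: le_trans (A_lb _).
rewrite -mulrA ler_pM2l // -exprMn -enorm_sq.
by rewrite lerXn2r ?nnegrE ?enorm_ge0 // mulr_ge0 ?ltW.
Qed.

Lemma eta_O j : (j <= m)%N -> isO e 2 (eta j).
Proof. by move=> jm; apply: (@vO_dot _ _ _ _ 1 1); exact: r_O. Qed.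

(** The residual r_(j+1) does at least as well as one plain step r_j - A r_j from
    r_j.  Near-orthogonality gives r_(j+1) . (r_j - A r_j) = |r_(j+1)|^2 up to
    O(e^3), so the inequality follows by expanding the square of the
    difference. *)
Lemma eta_decrease j : (j < m)%N ->
  Oge e 3 (fun t => eta j t - rho j t - eta j.+1 t).
Proof.
move=> jm.
have h1 : isO e 3 (fun t => vdot (r j.+1 t) (r j t) - eta j.+1 t).
  by apply: r_gram; rewrite leqnSn.
have h2 : isO e 3 (fun t => vdot (r j.+1 t) (A *m r j t)).
  by apply: r_Aorth; rewrite ltnSn.
have h3 := isO_Oge (isOM (isO_cst e 2) (isOB h1 h2)).
apply: Oge_mono h3 _ => t; rewrite /eta /rho.
have := contract_sq (r j t); set x := r j t; set y := r j.+1 t.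
have := vdot_ge0 (x - A *m x - y).
rewrite !vdotE (vdotC (A *m x)) (vdotC x y) (vdotC (A *m x) y); lra.
Qed.

(** Because the r_i are A-orthogonal, the coefficients of s_(j+1) - s_j are found
    by pairing with A r_i, and A (s_(j+1) - s_j) = r_j - r_(j+1) has the same inner
    product with every earlier residual.  This explicit formula is what gives the
    coefficients their sign. *)
Lemma step_coefs j : (j < m)%N ->
  exists c : nat -> T -> R,
    [/\ forall i, (i < j.+1)%N -> isO e 0 (c i),
        vO e 2 (fun t => s j.+1 t - s j t -
                         lincomb j.+1 (fun i => c i t) (fun i => r i t)) &
        forall i, (i < j.+1)%N ->
          isO e 3 (fun t => c i t * rho i t - (eta j t - eta j.+1 t))].
Proof.
move=> jm; have jj : (j <= j.+1 <= m)%N by rewrite leqnSn.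
have [c hc hz] := span_step jj; exists c; split => // i ij.
have ij' : (i <= j)%N by [].
have im : (i <= m)%N := leq_trans ij' (ltnW jm).
pose z t := s j.+1 t - s j t.
pose w t := lincomb j.+1 (fun i => c i t) (fun i => r i t).
have h1 : isO e 3 (fun t => vdot (r i t) (A *m z t) - (eta j t - eta j.+1 t)).
  have g1 : isO e 3 (fun t => vdot (r j t) (r i t) - eta j t).
    by apply: r_gram; rewrite ij' ltnW.
  have g2 : isO e 3 (fun t => vdot (r j.+1 t) (r i t) - eta j.+1 t).
    by apply: r_gram; rewrite (leq_trans ij' (leqnSn j)).
  have g3 := @vO_dot _ _ _ _ 1 2 _ _ (r_O im) (r_diff jj).
  apply: isO_ext (isOB (isOB g1 g2) g3) => t.
  rewrite /z !vdotDr !vdotNr (vdotC (r i t) (r j t)) (vdotC (r i t) (r j.+1 t)).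
  by rewrite -/(z t); ring.
have h2 : isO e 3 (fun t => vdot (r i t) (A *m (z t - w t))).
  by apply: (@vO_dot _ _ _ _ 1 2); [exact: r_O|exact: vO_mx].
have h3 : isO e 3 (fun t => vdot (r i t) (A *m w t) - c i t * rho i t).
  apply: (@isO_ext _ _ _ _ (fun t => \sum_(l < j.+1)
    (if l == i :> nat then 0 else c l t * vdot (r i t) (A *m r l t)))) => [t|].
    rewrite /w mulmx_lincomb (vdot_lincomb _ (fun l => c l t)).
    rewrite (bigD1 (Ordinal ij)) //= eqxx add0r [in RHS](bigD1 (Ordinal ij)) //=.
    rewrite addrAC subrr add0r; apply: eq_bigr => l li.
    by rewrite ifN //; apply: contra li => /eqP h; apply/eqP/val_inj.
  apply: (@isO_sum _ _ _ _ _ (fun l t =>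
    if l == i then 0 else c l t * vdot (r i t) (A *m r l t))) => l lj.
  case: (ltngtP l i) => [li|il|_]; last exact: isO0.
    apply: (@isOM _ _ _ 0 3); first exact: hc.
    by apply: r_Aorth; rewrite li.
  apply: (@isOM _ _ _ 0 3); first exact: hc.
  apply: isO_ext (@r_Aorth i l _) => [t|]; first exact: A_sym.
  by rewrite il /=; apply: leq_trans jm; rewrite ltnW.
apply: isO_ext (isOB (isOB h1 h2) h3) => t.
rewrite (mulmxBr A (z t) (w t)).
move: (z t) (w t) => z' w'; rewrite vdotDr vdotNr; ring.
Qed.

Lemma step_coefs_ge0 j (c : nat -> T -> R) i : (i <= j < m)%N ->
  isO e 3 (fun t => c i t * rho i t - (eta j t - eta j.+1 t)) ->
  Oge e 1 (c i).
Proof.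
move=> /andP[ij jm] h.
have h1 : Oge e 3 (fun t => c i t * rho i t).
  have g : Oge e 3 (fun t => eta j t - eta j.+1 t).
    by apply: Oge_mono (eta_decrease jm) _ => t; have := rho_ge0 j t; lra.
  exact: (Oge_isO g h).
have im := leq_ltn_trans ij jm.
have c2 : 0 < c0 * c1 ^+ 2 by rewrite mulr_gt0 // exprn_gt0.
case: (@Oge_div _ _ _ e_gt0 1 2 _ _ _ h1 c2 (rho_lb im)) => C C0 hC.
exists C => //; apply: (for_small_and_mono _ hC (rho_lb im)) => t.
rewrite /= => h2 h3; rewrite mulfK // in h2.
by rewrite gt_eqF //; apply: lt_le_trans h3; rewrite mulr_gt0 // exprn_gt0.
Qed.

(** By [eta_decrease] the numerator |r_j|^2 - |r_(j+1)|^2 dominates the denominator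
    r_j . A r_j of the last coefficient. *)
Lemma step_coefs_ge1 j (c : nat -> T -> R) : (j < m)%N ->
  isO e 3 (fun t => c j t * rho j t - (eta j t - eta j.+1 t)) ->
  Oge e 1 (fun t => c j t - 1).
Proof.
move=> jm h.
have h1 : Oge e 3 (fun t => (c j t - 1) * rho j t).
  apply: (Oge_isO (eta_decrease jm)); apply: isO_ext h => t; ring.
have c2 : 0 < c0 * c1 ^+ 2 by rewrite mulr_gt0 // exprn_gt0.
case: (@Oge_div _ _ _ e_gt0 1 2 _ _ _ h1 c2 (rho_lb jm)) => C C0 hC.
exists C => //; apply: (for_small_and_mono _ hC (rho_lb jm)) => t.
rewrite /= => h2 h3; rewrite mulfK // in h2.
by rewrite gt_eqF //; apply: lt_le_trans h3; rewrite mulr_gt0 // exprn_gt0.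
Qed.

Lemma Oge1_half F : Oge e 1 (fun t => F t - 1) ->
  for_small e (fun t => 2^-1 * e t ^+ 0 <= F t).
Proof.
move=> [C C0 hC]; have c3 : 0 < 2^-1 / (C + 1) :> R.
  by rewrite divr_gt0 // ltr_wpDl.
apply: (for_small_and_mono _ hC (for_small_le e c3)) => t h1 h2.
have h3 : (C + 1) * e t <= 2^-1.
  by rewrite mulrC -ler_pdivlMr // ltr_wpDl.
rewrite expr0 mulr1; rewrite expr1 in h1; have := e_gt0 t.
have : 2^-1 * 2 = 1 :> R by rewrite mulVf // pnatr_eq0.
lra.
Qed.

(** Solving r_j - r_(j+1) = sum_i c_i A r_i for A r_j, which is possible because
    the last coefficient is bounded away from 0. *)
Lemma span_Ar j : (j < m)%N -> in_span j.+2 (fun t => A *m r j t).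
Proof.
elim/ltn_ind: j => j IH jm.
have [c [hc hz hrho]] := step_coefs jm.
have cge := Oge1_half (step_coefs_ge1 jm (hrho _ (ltnSn j))).
have cinv : isO e 0 (fun t => 1 / c j t).
  apply: (@isO_div _ _ _ e_gt0 0 0 _ _ 2^-1) => //; exact: isO_cst.
have jj : (j <= j.+1 <= m)%N by rewrite leqnSn.
pose W t := r j t - r j.+1 t - (r j t - r j.+1 t - A *m (s j.+1 t - s j t))
  - A *m (s j.+1 t - s j t - lincomb j.+1 (fun i => c i t) (fun i => r i t))
  - lincomb j (fun i => c i t) (fun i => A *m r i t).
have WE t : W t = c j t *: (A *m r j t).
  by rewrite /W subKr -mulmxBr subKr mulmx_lincomb lincombS addrAC subrr add0r.
have hW : in_span j.+2 W.
  apply: spanD; last first.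
    apply/spanN/span_lincomb => i ij; first by apply: hc; exact: ltnW.
    apply: (@span_widen i.+2); first by rewrite !ltnS ltnW.
    by apply: IH => //; exact: ltn_trans jm.
  apply: spanD; last by apply/spanN/span_err/vO_mx.
  apply: spanD; last by apply/spanN/span_err/r_diff.
  by apply: spanD; [|apply: spanN]; apply: span_r.
have [d' d'0 hd'] := cge.
have [k hk hk2] := spanZ cinv hW; exists k => //.
apply: isO_le hk2; exists d' => // t /hd' h.
rewrite WE scalerA mul1r mulVf ?scale1r //.
by rewrite gt_eqF // (lt_le_trans _ h) // expr0 mulr1 invr_gt0.
Qed.

(** Write eta and rho for |r_(p+1)|^2 and r_(p+1) . A r_(p+1), c_i for the
    coefficients of s_(p+1) - s_p, and q for r_(p+1) . A^2 r_p.  The inner product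
    is (c_0 + ... + c_(p-1)) eta + (c_p - 1) (eta + q) up to O(e^3), and
    c_p q = - rho because A r_p is, up to terms that r_(p+1) does not see,
    (r_p - r_(p+1)) / c_p.  Since c_p >= 1 and rho <= eta, the sum eta + q is almost
    nonnegative as well. *)
Lemma krylov_descent p : (p < m)%N ->
  Oge e 3 (fun t => let w := s p.+1 t - s p t - r p t in
    vdot (r p.+1 t - A *m r p.+1 t) (w - A *m w)).
Proof.
move=> pm.
have [c [hc hz hrho]] := step_coefs pm.
have c1ge := step_coefs_ge1 pm (hrho _ (ltnSn p)).
have cge := Oge1_half c1ge.
have pp : (p <= p.+1 <= m)%N by rewrite leqnSn.
pose z t := s p.+1 t - s p t.
pose zc t := lincomb p.+1 (fun i => c i t) (fun i => r i t).
pose y t := lincomb p (fun i => c i t) (fun i => r i t).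
pose rp := r p.+1.
pose w t := s p.+1 t - s p t - r p t.
have rpO : vO e 1 rp by exact: r_O.
have zE t : zc t = y t + c p t *: r p t by exact: lincombS.
have f1 : isO e 3 (fun t => vdot (rp t) (A *m w t)).
  apply: (@r_span_orth p.+1 p.+1); first by rewrite leqnn.
  apply: spanD; first exact: span_step.
  exact/spanN/span_r.
have f2 : isO e 3 (fun t => vdot (rp t) (w t) -
    (\sum_(i < p) c i t + (c p t - 1)) * eta p.+1 t).
  have g1 : isO e 3 (fun t => vdot (rp t) (z t - zc t)).
    by apply: (@vO_dot _ _ _ _ 1 2).
  have g2 : isO e 3 (fun t => \sum_(i < p) c i t * (vdot (rp t) (r i t) - eta p.+1 t)).
    apply: (@isO_sum _ _ _ _ _
      (fun i t => c i t * (vdot (rp t) (r i t) - eta p.+1 t))) => i ip.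
    apply: (@isOM _ _ _ 0 3); first by apply: hc; exact: ltnW.
    by apply: r_gram; rewrite pm andbT ltnW // ltnW.
  have g3 : isO e 3 (fun t => (c p t - 1) * (vdot (rp t) (r p t) - eta p.+1 t)).
    apply: (@isOM _ _ _ 0 3); last by exact: r_gram.
    by apply: isOB; [exact: hc|exact: isO_cst].
  apply: isO_ext (isOD (isOD g1 g2) g3) => t.
  have -> : \sum_(i < p) c i t * (vdot (rp t) (r i t) - eta p.+1 t) =
            vdot (rp t) (y t) - (\sum_(i < p) c i t) * eta p.+1 t.
    rewrite /y (vdot_lincomb p (fun i => c i t)) mulr_suml -sumrB.
    by apply: eq_bigr => i _; rewrite mulrBr.
  rewrite /w -/(z t) zE; move: (z t) (y t) (rp t) (r p t) => z' y' rp' r'.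
  by rewrite !vdotE; ring.
(* Only the component of w along r_p survives in the quadratic term: A sends
   the span of r_0, ..., r_(p-1) into that of r_0, ..., r_p, and r_(p+1) is
   almost A-orthogonal to the latter. *)
have q_err : isO e 3 (fun t => vdot (rp t) (A *m (A *m (z t - zc t)))).
  by apply: (@vO_dot _ _ _ _ 1 2) => //; do 2!apply: vO_mx => //.
have q_y : isO e 3 (fun t => vdot (rp t) (A *m (A *m y t))).
  apply: (@r_span_orth p.+1 p.+1); first by rewrite leqnn.
  have /funext -> : forall t, A *m y t =
      lincomb p (fun i => c i t) (fun i => A *m r i t).
    by move=> t; rewrite mulmx_lincomb.
  apply: (span_lincomb (V := fun i t => A *m r i t)) => i ip.
    by apply: hc; exact: ltnW.
  apply: (@span_widen i.+2) => //.
  by apply: span_Ar; exact: ltn_trans pm.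
pose q t := vdot (rp t) (A *m (A *m r p t)).
have f3 : isO e 3 (fun t => vdot (rp t) (A *m (A *m w t)) - (c p t - 1) * q t).
  apply: isO_ext (isOD q_err q_y) => t.
  rewrite /w -/(z t) zE /q; move: (z t) (y t) (rp t) (r p t) => z' y' rp' r'.
  by rewrite !(mulmxDr, mulmxN) -?scalemxAr !vdotE; ring.
(* Here A (s_(p+1) - s_p) is evaluated as r_p - r_(p+1). *)
have f4 : isO e 3 (fun t => c p t * q t + rho p.+1 t).
  have g3 : isO e 3 (fun t => vdot (rp t) (A *m (r p t - rp t - A *m z t))).
    apply: (@vO_dot _ _ _ _ 1 2) => //; apply: vO_mx => //.
    exact: r_diff.
  have g4 : isO e 3 (fun t => vdot (rp t) (A *m r p t)).
    by apply: r_Aorth; rewrite ltnSn.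
  apply: isO_ext (isOB (isOB (isOB g4 g3) q_err) q_y) => t.
  rewrite zE /q /rho -/rp; move: (z t) (y t) (rp t) (r p t) => z' y' rp' r'.
  by rewrite !(mulmxDr, mulmxN) -?scalemxAr !vdotE; ring.
have qO : isO e 2 q.
  apply: (@vO_dot _ _ _ _ 1 1) => //; do 2!apply: vO_mx => //.
  exact/r_O/ltnW.
have etaO : isO e 2 (eta p.+1) by exact: eta_O.
have cpO : isO e 0 (c p) by exact: hc.
have cm1O : isO e 0 (fun t => c p t - 1).
  by apply: isOB => //; exact: isO_cst.
(* Multiplied by c_p, the claim becomes
   (c_p - 1) eta + (eta - rho) >= - O(e^3); both terms are almost nonnegative. *)
have f5 : Oge e 3 (fun t => eta p.+1 t + q t).
  have g : Oge e 3 (fun t => c p t * (eta p.+1 t + q t)).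
    have g1 : Oge e 3 (fun t => (c p t - 1) * eta p.+1 t).
      apply: (@OgeM _ _ _ e_gt0 3 1 0 3 2) c1ge cm1O _ etaO => //.
      by apply: Oge_ge0 => t; exact: vdot_ge0.
    have g2 : Oge e 3 (fun t => eta p.+1 t - rho p.+1 t).
      by apply: Oge_ge0 => t; rewrite subr_ge0 rho_ub.
    apply: (Oge_isO (OgeD g1 g2)); apply: isO_ext f4 => t; ring.
  have h20 : 0 < 2^-1 :> R by rewrite invr_gt0.
  case: (@Oge_div _ _ _ e_gt0 3 0 _ _ _ g h20 cge) => C C0 hC.
  exists C => //; apply: (for_small_and_mono _ hC cge) => t h1 h2.
  rewrite mulrAC divff ?mul1r // in h1.
  by rewrite gt_eqF // (lt_le_trans _ h2) // expr0 mulr1.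
have f6 : Oge e 3 (fun t => (c p t - 1) * (eta p.+1 t + q t)).
  apply: (@OgeM _ _ _ e_gt0 3 1 0 3 2) c1ge cm1O f5 _ => //.
  exact: isOD.
have f7 : Oge e 3 (fun t => (\sum_(i < p) c i t) * eta p.+1 t).
  apply: (@OgeM _ _ _ e_gt0 3 1 0 3 2) _ _ _ etaO => //.
  - apply: Oge_sum => i ip; apply: (@step_coefs_ge0 p) => //.
      by rewrite ltnW.
    exact/hrho/ltnW.
  - by apply: isO_sum => i ip; apply: hc; exact: ltnW.
  - by apply: Oge_ge0 => t; exact: vdot_ge0.
apply: (Oge_isO (OgeD f6 f7)).
apply: isO_ext (isOB (isOD f2 f3)
         (isOM (isO_cst e 2) f1)) => t.
rewrite /= -/(w t) -/rp /q; move: (w t) => w'.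
rewrite !vdotE (vdotC (A *m rp t) w') (vdotC (A *m rp t) (A *m w')).
rewrite (A_sym w') (A_sym (A *m w') (rp t)); ring.
Qed.

End ApproximateKrylov.

(** * Second-order calculus at the stationary point *)

Section Lines.
Variables (R : realType) (n : nat).
Implicit Types (F : 'cV[R]_n -> R) (y d z : 'cV[R]_n).

Lemma derive_grad F z d : differentiable F z -> 'D_d F z = vdot (grad F z) d.
Proof.
move=> dF; rewrite deriveE //.
have -> : d = \sum_(i < n) d i 0 *: delta_mx i 0.
  apply/colP => i; rewrite summxE (bigD1 i) //= big1 => [|j ji].
    by rewrite addr0 !mxE !eqxx mulr1.
  by rewrite !mxE eq_sym (negbTE ji) mulr0.
rewrite linear_sum /vdot; apply: eq_bigr => i _.
rewrite linearZ /= mxE deriveE // mulrC; congr (_ * _).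
rewrite summxE (bigD1 i) //= big1 => [|j ji].
  by rewrite addr0 !mxE !eqxx mulr1.
by rewrite !mxE eq_sym (negbTE ji) mulr0.
Qed.

(** The difference quotients of F along the line are those of the directional
    derivative. *)
Lemma is_derive_line F y d (t : R) : differentiable F (y + t *: d) ->
  is_derive t 1 (fun u : R => F (y + u *: d)) (vdot (grad F (y + t *: d)) d).
Proof.
move=> dF.
have E : (fun h : R => h^-1 *: ((F \o shift (y + t *: d)) (h *: d) - F (y + t *: d)))
  = (fun h : R => h^-1 *: (((fun u : R => F (y + u *: d)) \o shift t) (h *: (1 : R))
                      - F (y + t *: d))).
  apply/funext => h /=; congr (_ *: (F _ - _)).
  by rewrite scalerDl addrCA [h%:A]mulr1.
have dd : derivable F (y + t *: d) d by exact: diff_derivable.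
apply: DeriveDef; first by rewrite /derivable -E.
by rewrite -derive_grad // /derive -E.
Qed.

Lemma mvt01 (phi dphi : R -> R) :
  (forall t : R, 0 <= t <= 1 -> is_derive t 1 phi (dphi t)) ->
  exists2 c, 0 <= c <= 1 & phi 1 - phi 0 = dphi c.
Proof.
move=> h.
have h1 (t : R) : t \in `]0, 1[%R -> is_derive t 1 phi (dphi t).
  by rewrite in_itv /= => /andP[a b]; apply: h; rewrite !ltW.
have h2 : {within `[0, 1], continuous phi}.
  by apply: derivable_within_continuous => t; rewrite in_itv /= => /h.
have [c] := MVT ltr01 h1 h2.
rewrite in_itv /= => /andP[a b] ->; exists c; first by rewrite !ltW.
by rewrite subr0 mulr1.
Qed.

Lemma eball_segment (c x y : 'cV[R]_n) (r t : R) :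
  eball c r x -> eball c r y -> 0 <= t <= 1 -> eball c r (y + t *: (x - y)).
Proof.
rewrite /eball /= => hx hy /andP[t0 t1].
have -> : y + t *: (x - y) - c = t *: (x - c) + (1 - t) *: (y - c).
  by apply/colP => i; rewrite !mxE; ring.
apply: le_lt_trans (enormD _ _) _.
rewrite !enormZ !ger0_norm ?subr_ge0 //.
have [->|t'] := eqVneq t 0; first by rewrite mul0r subr0 mul1r add0r.
have {t'} t0' : 0 < t by rewrite lt_neqAle eq_sym t'.
have h : t * enorm (x - c) < t * r by rewrite ltr_pM2l.
have h' : (1 - t) * enorm (y - c) <= (1 - t) * r.
  by rewrite ler_wpM2l ?subr_ge0 // ltW.
by have := ltr_leD h h'; lra.
Qed.

End Lines.

Lemma le0_of_small (R : realType) (a K d : R) : 0 < d ->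
  (forall t, 0 < t -> t <= d -> a <= K * t) -> a <= 0.
Proof.
move=> d0 h; rewrite leNgt; apply/negP => a0.
have K0 : 0 < `|K| + 1 by rewrite ltr_wpDl.
pose t := Num.min d (a / (2 * (`|K| + 1))).
have t0 : 0 < t by rewrite lt_min d0 divr_gt0 // mulr_gt0.
have td : t <= d by rewrite ge_min lexx.
have t2 : t <= a / (2 * (`|K| + 1)) by rewrite ge_min lexx orbT.
have := h t t0 td; move: t2; rewrite ler_pdivlMr ?mulr_gt0 //.
have := ler_norm K; set k := `|K| in K0 *.
nra.
Qed.

Section SecondOrder.
Variables (R : realType) (n : nat) (f : 'cV[R]_n -> R).
Variables (r LH : R) (xs : 'cV[R]_n).
Hypothesis f_diff : forall x, differentiable f x.
Hypothesis r_gt0 : 0 < r.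
Hypothesis f_hess : hess_lipschitz_on (eball xs r) LH f.
Hypothesis xs_stat : grad f xs = 0.

Variable Q : 'M[R]_n.
Hypothesis QE : Q = hess f xs.

Let xs_ball : eball xs r xs.
Proof. by rewrite /eball /= subrr enorm0. Qed.

(** Paired with a fixed vector w, the gradient along the segment is a real function
    of one variable, so the mean value theorem applies; taking for w the remainder
    itself turns the scalar bound into a bound on its norm. *)
Lemma grad_expand x y : eball xs r x -> eball xs r y ->
  enorm (grad f x - grad f y - Q *m (x - y)) <=
    `|LH| * (enorm (x - xs) + enorm (y - xs)) * enorm (x - y).
Proof.
move=> bx bY.
set d := x - y; set bnd := `|LH| * _ * _.
have [dg hl] := f_hess.
suff key w : vdot w (grad f x - grad f y - Q *m d) <= enorm w * bnd.
  move: (grad f x - grad f y - Q *m d) key => w key.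
  have [->|w0] := eqVneq w 0.
    by rewrite enorm0 !mulr_ge0 ?addr_ge0 ?enorm_ge0.
  have ew : 0 < enorm w by rewrite lt_neqAle eq_sym enorm_eq0 w0 enorm_ge0.
  by rewrite -(ler_pM2l ew) -expr2 enorm_sq.
pose phi (t : R) := vdot w (grad f (y + t *: d)).
pose dphi (t : R) := vdot w (hess f (y + t *: d) *m d).
have [c c01 hc] : exists2 c, 0 <= c <= 1 & phi 1 - phi 0 = dphi c.
  apply: mvt01 => t t01.
  have dgt := dg _ (eball_segment bx bY t01).
  have -> : dphi t =
      \sum_(i < n) w i 0 *: vdot (grad (fun z => grad f z i 0) (y + t *: d)) d.
    apply: eq_bigr => i _; congr (_ * _).
    by rewrite mxE; apply: eq_bigr => j _; rewrite !mxE.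
  have -> : phi = \sum_(i < n) (w i 0 *: (fun u : R => grad f (y + u *: d) i 0)).
    by apply/funext => u; rewrite /phi /vdot fct_sumE.
  apply: is_derive_sum => i; apply: is_deriveZ.
  apply: (is_derive_line (F := fun z => grad f z i 0)).
  exact: (differentiable_comp dgt (differentiable_coord _ i 0)).
set xi := y + c *: d in hc.
have bxi : eball xs r xi by exact: eball_segment.
have -> : vdot w (grad f x - grad f y - Q *m d) = vdot w ((hess f xi - Q) *m d).
  move: hc; rewrite /phi /dphi -/xi scale1r scale0r addr0 /d (addrC y) subrK -/d.
  rewrite (mulmxBl (hess f xi) Q d).
  move: (hess f xi *m d) (Q *m d) (grad f x) (grad f y) => a b p q.
  by rewrite !vdotE => ->.
have xi_le : enorm (xi - xs) <= enorm (x - xs) + enorm (y - xs).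
  have -> : xi - xs = c *: (x - xs) + (1 - c) *: (y - xs).
    by rewrite /xi /d; apply/colP => i; rewrite !mxE; ring.
  case/andP: c01 => c0 c1.
  apply: le_trans (enormD _ _) _; rewrite !enormZ !ger0_norm ?subr_ge0 //.
  by apply: lerD; rewrite ler_piMl ?enorm_ge0 // lerBlDr lerDl.
apply: le_trans (vdot_le _ _) _; rewrite ler_wpM2l ?enorm_ge0 //.
apply: le_trans (spectral_norm_le _ _) _; rewrite ler_wpM2r ?enorm_ge0 //.
rewrite QE; apply: le_trans (hl _ _ bxi xs_ball) _.
apply: le_trans (ler_wpM2r (enorm_ge0 _) (ler_norm _)) _.
by rewrite ler_wpM2l.
Qed.

Lemma grad_expand0 x : eball xs r x ->
  enorm (grad f x - Q *m (x - xs)) <= `|LH| * enorm (x - xs) ^+ 2.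
Proof.
move=> bx; have := grad_expand bx xs_ball.
by rewrite xs_stat !subr0 subrr enorm0 addr0 expr2 mulrA.
Qed.

(** Mean value theorem for f along the segment minus its quadratic model, whose
    derivative is the remainder of [grad_expand0]. *)
Lemma f_expand d : eball xs r (xs + d) ->
  `|f (xs + d) - f xs - 2^-1 * vdot d (Q *m d)| <= `|LH| * enorm d ^+ 3.
Proof.
move=> bd.
pose K := 2^-1 * vdot d (Q *m d).
pose phi (t : R) := f (xs + t *: d) - K * t ^+ 2.
pose dphi (t : R) := vdot (grad f (xs + t *: d)) d - K * (2 * t).
have [c c01 hc] : exists2 c, 0 <= c <= 1 & phi 1 - phi 0 = dphi c.
  apply: mvt01 => t t01.
  apply: is_deriveB; first exact: is_derive_line.
  have h : is_derive t (1 : R) (K *: (fun u : R => u ^+ 2)) (K *: (2 * t)).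
    apply: is_deriveZ.
    have := is_deriveM (is_derive_id t (1 : R)) (is_derive_id t (1 : R)).
    have -> : t *: (1 : R) + t *: (1 : R) = 2 * t by rewrite [t%:A]mulr1; ring.
    by [].
  exact: h.
have bc : eball xs r (xs + c *: d).
  by have := eball_segment bd xs_ball c01; rewrite addrAC subrr add0r.
move: hc; rewrite /phi /dphi scale1r scale0r addr0 expr1n expr0n mulr1 mulr0 subr0.
rewrite -/K => hc.
have -> : f (xs + d) - f xs - K = vdot (grad f (xs + c *: d) - Q *m (c *: d)) d.
  rewrite -scalemxAr !vdotE (vdotC (Q *m d)).
  have <- : 2 * K = vdot d (Q *m d) by rewrite /K mulrA divff ?mul1r ?pnatr_eq0.
  by rewrite addrAC hc; ring.
apply: le_trans (cauchy_schwarz _ _) _.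
rewrite exprSr mulrA ler_wpM2r ?enorm_ge0 //.
have := grad_expand0 bc; rewrite addrAC subrr add0r => /le_trans; apply.
rewrite ler_wpM2l // lerXn2r ?nnegrE ?enorm_ge0 // enormZ.
by case/andP: c01 => c0 c1; rewrite ger0_norm // ler_piMl ?enorm_ge0.
Qed.

Lemma small_ball (u : 'cV[R]_n) : exists2 d, 0 < d &
  forall t, 0 <= t -> t <= d -> eball xs r (xs + t *: u).
Proof.
have u0 : 0 < enorm u + 1 by rewrite ltr_wpDl ?enorm_ge0.
exists (r / 2 / (enorm u + 1)); first by rewrite !divr_gt0.
move=> t t0; rewrite ler_pdivlMr // => h; rewrite /eball /= addrAC subrr add0r.
rewrite enormZ ger0_norm //; move: t0 h r_gt0; move: (enorm u) => N; lra.
Qed.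

(** The second difference is symmetric in u and v, but applying the mean value
    theorem in the direction v shows it to be v . Q u to leading order; this yields
    [hess_sym]. *)
Lemma second_difference u v : exists K d, 0 < d /\
  forall t, 0 < t -> t <= d ->
  `|f (xs + t *: u + t *: v) - f (xs + t *: u) - f (xs + t *: v) + f xs
    - t ^+ 2 * vdot v (Q *m u)| <= K * t ^+ 3.
Proof.
pose N := enorm u + enorm v.
have N0 : 0 <= N by rewrite addr_ge0 ?enorm_ge0.
exists (`|LH| * (2 * N) * enorm u * enorm v), (r / 2 / (N + 1)).
have N1 : 0 < N + 1 by rewrite ltr_wpDl.
split; first by rewrite !divr_gt0.
move=> t t0; rewrite ler_pdivlMr // => ht.
pose phi (tau : R) := f ((xs + t *: u) + tau *: (t *: v)) - f (xs + tau *: (t *: v)).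
pose dphi (tau : R) := vdot (grad f ((xs + t *: u) + tau *: (t *: v))) (t *: v)
   - vdot (grad f (xs + tau *: (t *: v))) (t *: v).
have [c /andP[c0 c1] hc] : exists2 c, 0 <= c <= 1 & phi 1 - phi 0 = dphi c.
  by apply: mvt01 => tau _; apply: is_deriveB; exact: is_derive_line.
have etv : enorm (c *: (t *: v)) <= t * enorm v.
  by rewrite !enormZ (ger0_norm c0) (gtr0_norm t0) ler_piMl ?mulr_ge0 ?enorm_ge0 ?(ltW t0).
have etu : enorm (t *: u) = t * enorm u by rewrite enormZ gtr0_norm.
set y := xs + c *: (t *: v) in hc *.
set x := xs + t *: u + c *: (t *: v) in hc *.
have yE : y - xs = c *: (t *: v) by rewrite /y addrAC subrr add0r.
have xE : x - xs = t *: u + c *: (t *: v).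
  by rewrite /x; apply/colP => i; rewrite !mxE; ring.
have xyE : x - y = t *: u.
  by rewrite /x /y; apply/colP => i; rewrite !mxE; ring.
have ex : enorm (x - xs) <= t * N.
  by rewrite xE; apply: le_trans (enormD _ _) _; rewrite etu /N mulrDr lerD2l.
have ey : enorm (y - xs) <= t * N.
  by rewrite yE; apply: le_trans etv _; rewrite /N mulrDr lerDr mulr_ge0 ?enorm_ge0 ?(ltW t0).
have tN : t * N < r by move: (ltW t0) ht r_gt0; lra.
have bx : eball xs r x by exact: le_lt_trans ex tN.
have bY : eball xs r y by exact: le_lt_trans ey tN.
have := grad_expand bx bY; rewrite xyE => hg.
have -> : f (xs + t *: u + t *: v) - f (xs + t *: u) - f (xs + t *: v) + f xs
    - t ^+ 2 * vdot v (Q *m u) = vdot (grad f x - grad f y - Q *m (t *: u)) (t *: v).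
  move: hc; rewrite /phi /dphi -/x -/y !scale1r !scale0r !addr0 => hc.
  rewrite 2!vdotDl !vdotNl -hc -scalemxAr !(vdotZl, vdotZr) (vdotC v); ring.
apply: le_trans (cauchy_schwarz _ _) _.
rewrite [enorm (t *: v)]enormZ (gtr0_norm t0).
apply: (@le_trans _ _ (`|LH| * (2 * (t * N)) * (t * enorm u) * (t * enorm v))).
  rewrite ler_wpM2r ?mulr_ge0 ?enorm_ge0 ?(ltW t0) //; apply: le_trans hg _.
  rewrite etu ler_wpM2r ?mulr_ge0 ?enorm_ge0 ?(ltW t0) // ler_wpM2l //.
  by have := lerD ex ey; lra.
by rewrite le_eqVlt; apply/orP; left; apply/eqP; ring.
Qed.

Lemma hess_sym u v : vdot u (Q *m v) = vdot v (Q *m u).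
Proof.
suff half a b : vdot a (Q *m b) - vdot b (Q *m a) <= 0.
  by apply/eqP; rewrite eq_le; have := half u v; have := half v u; lra.
have [K [d [d0 hK]]] := second_difference b a.
have [K' [d' [d'0 hK']]] := second_difference a b.
have dd : 0 < Num.min d d' by rewrite lt_min d0.
apply: (@le0_of_small _ _ (K + K') _ dd) => t t0; rewrite le_min => /andP[td td'].
have h1 := hK t t0 td; have h2 := hK' t t0 td'.
rewrite -(@ler_pM2l _ (t ^+ 2)) ?exprn_gt0 //.
move: h1 h2; rewrite (addrAC xs (t *: a)).
rewrite !ler_norml => /andP[h1 h1'] /andP[h2 h2'].
have -> : t ^+ 2 * ((K + K') * t) = K * t ^+ 3 + K' * t ^+ 3 by ring.
lra.
Qed.

Lemma hess_le L u : grad_lipschitz f L -> vdot u (Q *m u) <= L * vdot u u.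
Proof.
move=> hL; rewrite -subr_le0.
have [d d0 hd] := small_ball u.
apply: (@le0_of_small _ _ (`|LH| * enorm u ^+ 3) _ d0) => t t0 td.
have hg := grad_expand0 (hd t (ltW t0) td).
have := hL (xs + t *: u) xs; move: hg.
rewrite xs_stat subr0 addrAC subrr add0r => hg hl.
set g := grad f (xs + t *: u) in hg hl.
have h1 : vdot u g <= L * t * vdot u u.
  apply: le_trans (vdot_le _ _) _; rewrite -enorm_sq.
  rewrite enormZ (gtr0_norm t0) in hl.
  by have := ler_wpM2l (enorm_ge0 u) hl; rewrite expr2; lra.
have h2 : vdot u (Q *m (t *: u) - g) <= `|LH| * t ^+ 2 * enorm u ^+ 3.
  apply: le_trans (vdot_le _ _) _; rewrite -opprB enormN.
  rewrite enormZ (gtr0_norm t0) in hg.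
  by have := ler_wpM2l (enorm_ge0 u) hg; rewrite exprMn; lra.
rewrite -(@ler_pM2l _ t) //.
move: h2; rewrite -scalemxAr !vdotE expr2; lra.
Qed.

(** Strong convexity at the midpoint of xs + t u and xs - t u, compared with the
    quadratic model of f as t tends to 0. *)
Lemma hess_ge mu u : strongly_convex_on (eball xs r) mu f ->
  mu * vdot u u <= vdot u (Q *m u).
Proof.
move=> hmu; rewrite -subr_le0.
have [d1 d10 hd1] := small_ball u.
have [d2 d20 hd2] := small_ball (- u).
have dd : 0 < Num.min d1 d2 by rewrite lt_min d10.
apply: (@le0_of_small _ _ (2 * (`|LH| * enorm u ^+ 3)) _ dd) => t t0.
rewrite le_min => /andP[td1 td2].
have b1 := hd1 t (ltW t0) td1; have b2 := hd2 t (ltW t0) td2.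
have h1 := f_expand b1; have h2 := f_expand b2.
have h3 : 0 <= (2^-1 : R) <= 1.
  by rewrite invr_ge0 ler0n invf_le1 ?ler1n ?ltr0n.
have := hmu _ _ _ b1 b2 h3.
have -> : 2^-1 *: (xs + t *: u) + (1 - 2^-1) *: (xs + t *: - u) = xs.
  by apply/colP => i; rewrite !mxE; field.
have -> : xs + t *: u - (xs + t *: - u) = (2 * t) *: u.
  by apply/colP => i; rewrite !mxE; ring.
rewrite enorm_sq !vdotE => h4.
move: h1 h2; rewrite !enormZ enormN (gtr0_norm t0) !exprMn.
rewrite -!scalemxAr mulmxN !vdotE !ler_norml => /andP[h1 h1'] /andP[h2 h2'].
rewrite -(@ler_pM2l _ (t ^+ 2)) ?exprn_gt0 //.
have -> : t ^+ 2 * (2 * (`|LH| * enorm u ^+ 3) * t) =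
          2 * (`|LH| * (t ^+ 3 * enorm u ^+ 3)) by ring.
have e2 : 2^-1 * 2 = 1 :> R by rewrite mulVf // pnatr_eq0.
set A := f (xs + t *: u) in h1 h1' h4 *.
set B := f (xs + t *: - u) in h2 h2' h4 *.
set q := vdot u (Q *m u) in h1 h1' h2 h2' *; set w := vdot u u in h4 *.
set E := `|LH| * _ in h1 h1' h2 h2' *.
rewrite expr2; lra.
Qed.

End SecondOrder.

(** * One restart cycle *)

(** Here h is the residual map, known only through its expansion near its zero xs.
    The index t ranges over a family of cycles y_0, ..., y_(m+1), and the condition
    number appears as the independence bound [dx_indep]. *)
Section Cycle.
Variables (R : realType) (T : Type) (e : T -> R).
Hypothesis e_gt0 : forall t, 0 < e t.
Variables (n : nat) (A : 'M[R]_n) (c0 : R).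
Hypothesis A_sym : forall u v, vdot u (A *m v) = vdot v (A *m u).
Hypothesis c0_gt0 : 0 < c0.
Hypothesis A_lb : forall u, c0 * vdot u u <= vdot u (A *m u).
Hypothesis A_ub : forall u, vdot u (A *m u) <= vdot u u.
Variables (h : 'cV[R]_n -> 'cV[R]_n) (xs : 'cV[R]_n) (rad K : R).
Hypothesis rad_gt0 : 0 < rad.
Hypothesis K_ge0 : 0 <= K.
Hypothesis h_expand : forall x y, eball xs rad x -> eball xs rad y ->
  enorm (h x - h y + A *m (x - y)) <=
    K * (enorm (x - xs) + enorm (y - xs)) * enorm (x - y).
Hypothesis h_xs : h xs = 0.
Variables (m : nat) (M : R).
Hypothesis M_gt0 : 0 < M.
Variables (y : nat -> T -> 'cV[R]_n) (al : nat -> nat -> T -> R).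
Hypothesis eE : forall t, e t = enorm (y 0%N t - xs).

Let dx i t := y i.+1 t - y 0%N t.
Let dh i t := h (y i.+1 t) - h (y 0%N t).
Let s j t := lincomb j (fun i => al j i t) (fun i => dx i t).
Let r j t := h (y 0%N t) + lincomb j (fun i => al j i t) (fun i => dh i t).

Hypothesis y_step : forall j t, (j <= m)%N -> y j.+1 t = y 0%N t + s j t + r j t.
Hypothesis r_orth_dh : forall i j t, (i < j <= m)%N -> vdot (r j t) (dh i t) = 0.
Hypothesis dx_indep : forall (b : nat -> R) i t, (i < m)%N ->
  enorm (h (y 0%N t)) * `|b i| <= M * enorm (lincomb m b (fun i => dx i t)).

Lemma dxE j t : (j <= m)%N -> dx j t = s j t + r j t.
Proof.
move=> jm; rewrite /dx y_step //.
by apply/colP => i; rewrite !mxE; ring.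
Qed.

Lemma in_ball (z : T -> 'cV[R]_n) : vO e 1 (fun t => z t - xs) ->
  for_small e (fun t => eball xs rad (z t)).
Proof.
move=> [C C0 hC]; have C1 : 0 < rad / 2 / (C + 1).
  by rewrite !divr_gt0 // ltr_wpDl.
apply: (for_small_and_mono _ hC (for_small_le e C1)) => t h1 h2.
rewrite /eball /=; have {}h2 : (C + 1) * e t <= rad / 2.
  by rewrite mulrC -ler_pdivlMr // ltr_wpDl.
rewrite ger0_norm ?enorm_ge0 // expr1 in h1.
move: (e_gt0 t) rad_gt0 => ? ?; lra.
Qed.

Lemma y0_O : vO e 1 (fun t => y 0%N t - xs).
Proof.
exists 1 => //; exists 1 => // t _.
by rewrite ger0_norm ?enorm_ge0 // -eE expr1 mul1r.
Qed.

Lemma h_expandO (z w : T -> 'cV[R]_n) :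
  vO e 1 (fun t => z t - xs) -> vO e 1 (fun t => w t - xs) ->
  vO e 2 (fun t => h (z t) - h (w t) + A *m (z t - w t)).
Proof.
move=> hz hw.
have hB : isO e 2 (fun t =>
    K * (enorm (z t - xs) + enorm (w t - xs)) * enorm (z t - w t)).
  apply: (@isOM _ _ _ 1 1).
    by apply: (@isOM _ _ _ 0 1); [exact: isO_cst|exact: isOD].
  apply: (vO_ext _ (vOB hz hw)) => t.
  by rewrite opprB addrA subrK.
apply: isO_le hB; apply: (for_small_and_mono _ (in_ball hz) (in_ball hw)) => t bz bw.
rewrite !ger0_norm ?enorm_ge0 ?mulr_ge0 ?addr_ge0 ?enorm_ge0 //.
exact: h_expand.
Qed.

Lemma h_affine0 (z : T -> 'cV[R]_n) : vO e 1 (fun t => z t - xs) ->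
  vO e 2 (fun t => h (z t) + A *m (z t - xs)).
Proof.
move=> hz; have hx : vO e 1 (fun=> xs - xs).
  by apply: vO_ext (vO0 e n 1) => t; rewrite subrr.
by apply: vO_ext (h_expandO hz hx) => t; rewrite h_xs subr0.
Qed.

Lemma h_O (z : T -> 'cV[R]_n) : vO e 1 (fun t => z t - xs) -> vO e 1 (fun t => h (z t)).
Proof.
move=> hz; apply: vO_ext (vOB (vO_weak e_gt0 _ (h_affine0 hz)) (vO_mx A hz)) => //.
by move=> t; rewrite addrK.
Qed.

Lemma mx_lb u : c0 * enorm u <= enorm (A *m u).
Proof.
have [->|u0] := eqVneq u 0; first by rewrite mulmx0 enorm0 mulr0.
have eu : 0 < enorm u by rewrite lt_neqAle eq_sym enorm_eq0 u0 enorm_ge0.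
rewrite -(ler_pM2l eu); apply: le_trans (vdot_le _ _).
by apply: le_trans (A_lb u); rewrite -enorm_sq; lra.
Qed.

(** As A is bounded below, |h(y_0)| is comparable with the scale e. *)
Lemma h0_lb : for_small e (fun t => c0 / 2 * e t <= enorm (h (y 0%N t))).
Proof.
have [C C0 hC] := h_affine0 y0_O.
have C1 : 0 < c0 / 2 / (C + 1) by rewrite !divr_gt0 // ltr_wpDl.
apply: (for_small_and_mono _ hC (for_small_le e C1)) => t h1 h2.
have {}h2 : (C + 1) * e t <= c0 / 2.
  by rewrite mulrC -ler_pdivlMr // ltr_wpDl.
rewrite ger0_norm ?enorm_ge0 // in h1.
have h3 := mx_lb (y 0%N t - xs); rewrite -eE in h3.
have := enormBD (h (y 0%N t) + A *m (y 0%N t - xs)) (h (y 0%N t)).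
rewrite addrAC subrr add0r => h4.
move: (e_gt0 t) => et; have := ler_wpM2r (ltW et) h2.
rewrite expr2 in h1; nra.
Qed.

Lemma h0_gt0 : for_small e (fun t => 0 < enorm (h (y 0%N t))).
Proof.
apply: for_small_mono h0_lb => t; apply: lt_le_trans.
by rewrite mulr_gt0 // divr_gt0.
Qed.

Lemma al_bound j i t : (i < j <= m)%N ->
  enorm (h (y 0%N t)) * `|al j i t| <= M * enorm (s j t).
Proof.
move=> /andP[ij jm].
have := @dx_indep (fun i => if (i < j)%N then al j i t else 0) i t (leq_trans ij jm).
by rewrite lincomb_widen // ij.
Qed.

Lemma r_norm j t : (j <= m)%N -> enorm (r j t) <= enorm (h (y 0%N t)).
Proof.
move=> jm; apply: ler_enorm.
have : vdot (r j t) (r j t - h (y 0%N t)) = 0.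
  rewrite {2}/r [h _ + _]addrC addrK.
  rewrite (vdot_lincomb j (fun i => al j i t) (fun i => dh i t)) big1 // => i _.
  by rewrite r_orth_dh ?mulr0 // ltn_ord.
have := vdot_ge0 (r j t - h (y 0%N t)).
move: (r j t) (h (y 0%N t)) => a b; rewrite !vdotE (vdotC b a); lra.
Qed.

Definition cycle_bounds j := [/\ vO e 1 (s j), vO e 1 (r j),
   forall i, (i < j)%N -> isO e 0 (al j i) &
   vO e 2 (fun t => r j t - (h (y 0%N t) - A *m s j t))].

(** The size of s_j is not known beforehand, since the least-squares coefficients
    could be large.  Let pert be the combination of the errors dh_i + A dx_i with
    these coefficients, so that A s_j = pert - (r_j - r_0).  By [dx_indep] the
    coefficients are at most a multiple of |s_j| / e, and the errors are O(e^2), so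
    pert is O(e) |s_j| and is absorbed by c0 |s_j| <= |A s_j|.  Hence s_j is O(e),
    and the coefficients are then bounded. *)
Lemma cycle_boundsP j : (j <= m)%N -> cycle_bounds j.
Proof.
elim/ltn_ind: j => j IH jm.
have dxO i : (i < j)%N -> vO e 1 (dx i).
  move=> ij; have im : (i <= m)%N := leq_trans (ltnW ij) jm.
  have [h1 h2 _ _] := IH i ij im.
  by apply: vO_ext (vOD h1 h2) => t; rewrite dxE.
have yO i : (i < j)%N -> vO e 1 (fun t => y i.+1 t - xs).
  move=> ij; apply: vO_ext (vOD (dxO i ij) y0_O) => t.
  by rewrite /dx addrA subrK.
have dhO i : (i < j)%N -> vO e 2 (fun t => dh i t + A *m dx i t).
  by move=> ij; exact: h_expandO (yO i ij) y0_O.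
have h0O : vO e 1 (fun t => h (y 0%N t)) by apply: h_O; exact: y0_O.
have rO : vO e 1 (r j).
  apply: isO_le h0O; exists 1 => // t _.
  by rewrite !ger0_norm ?enorm_ge0 // r_norm.
pose pert t := lincomb j (fun i => al j i t) (fun i => dh i t + A *m dx i t).
have pertE t : pert t = r j t - h (y 0%N t) + A *m s j t.
  rewrite /r [h _ + _]addrC addrK mulmx_lincomb /pert /lincomb -big_split /=.
  by apply: eq_bigr => i _; rewrite scalerDr.
pose E t := \sum_(i < j) enorm (dh i t + A *m dx i t).
have EO : isO e 2 E.
  by apply: (@isO_sum _ _ _ _ _ (fun i t => enorm (dh i t + A *m dx i t))).
have pert_le t : enorm (h (y 0%N t)) * enorm (pert t) <= M * enorm (s j t) * E t.
  apply: le_trans (ler_wpM2l (enorm_ge0 _)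
    (enorm_sum j (fun i => al j i t *: (dh i t + A *m dx i t)))) _.
  rewrite /E !mulr_sumr; apply: ler_sum => i _; rewrite enormZ mulrA.
  by rewrite ler_wpM2r ?enorm_ge0 // al_bound // ltn_ord.
have sO : vO e 1 (s j).
  have [C C0 hC] := EO.
  have C1 : 0 < c0 / 2 * (c0 / 2) / (M * (C + 1)).
    by rewrite divr_gt0 ?mulr_gt0 ?divr_gt0 // ltr_wpDl.
  apply: (@isO_le _ _ _ _ _ (fun t => 2 / c0 * enorm (r j t - h (y 0%N t)))).
    apply: (for_small_and_mono _ (for_small_and h0_lb hC) (for_small_le e C1)).
    move=> t [h1 h2] h3.
    rewrite !ger0_norm ?mulr_ge0 ?enorm_ge0 ?invr_ge0 ?(ltW c0_gt0) //.
    have et := e_gt0 t.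
    have {}h3 : M * (C + 1) * e t <= c0 / 2 * (c0 / 2).
      by rewrite mulrC -ler_pdivlMr // mulr_gt0 // ltr_wpDl.
    have h4 : enorm (pert t) <= c0 / 2 * enorm (s j t).
      have p0 : 0 < c0 / 2 * e t by rewrite mulr_gt0 ?divr_gt0.
      rewrite -(ler_pM2l p0).
      apply: (@le_trans _ _ (enorm (h (y 0%N t)) * enorm (pert t))).
        by rewrite ler_wpM2r ?enorm_ge0.
      apply: le_trans (pert_le t) _.
      apply: (@le_trans _ _ (M * enorm (s j t) * (C * e t ^+ 2))).
        rewrite ler_wpM2l ?mulr_ge0 ?enorm_ge0 ?(ltW M_gt0) //.
        exact: le_trans (ler_norm _) h2.
      have := ler_wpM2r (mulr_ge0 (ltW et) (enorm_ge0 (s j t))) h3.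
      have := enorm_ge0 (s j t); set S := enorm (s j t) => S0.
      have q0 : 0 <= M * e t * (e t * S).
        by rewrite !mulr_ge0 // ltW.
      rewrite expr2; lra.
    have h5 := mx_lb (s j t).
    have h6 : enorm (A *m s j t) <= enorm (pert t) + enorm (r j t - h (y 0%N t)).
      apply: le_trans (enormBD _ _); rewrite pertE addrAC subrr add0r //.
    rewrite -(ler_pM2l c0_gt0) [leRHS]mulrA [c0 * (2 / c0)]mulrC divfK ?gt_eqF //.
    lra.
  apply: (@isOM _ _ _ 0 1); first exact: isO_cst.
  exact: vOB rO h0O.
have alO i : (i < j)%N -> isO e 0 (al j i).
  move=> ij.
  have c02 : 0 < c0 / 2 by rewrite divr_gt0.
  have h0_lb' : for_small e (fun t => c0 / 2 * e t ^+ 1 <= enorm (h (y 0%N t))).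
    exact: h0_lb.
  have hd : isO e 1 (fun t => M * enorm (s j t)).
    by apply: (@isOM _ _ _ 0 1) => //; exact: isO_cst.
  apply: isO_le (@isO_div _ _ _ e_gt0 0 1 _ _ _ hd c02 h0_lb').
  apply: for_small_mono h0_gt0 => t h1.
  rewrite [leRHS]ger0_norm ?divr_ge0 ?mulr_ge0 ?enorm_ge0 ?(ltW M_gt0) //.
  by rewrite ler_pdivlMr // mulrC al_bound // ij.
split => //.
have -> : (fun t => r j t - (h (y 0%N t) - A *m s j t)) = pert.
  by apply/funext => t; rewrite pertE opprB addrA addrAC.
apply: (@vO_sum _ _ _ _ 2 _ (fun i t => al j i t *: (dh i t + A *m dx i t))).
by move=> i ij; apply: (@vOZ _ _ _ _ 0 2); [exact: alO|exact: dhO].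
Qed.

Lemma dx_O j : (j <= m)%N -> vO e 1 (dx j).
Proof.
move=> jm; have [h1 h2 _ _] := cycle_boundsP jm.
by apply: vO_ext (vOD h1 h2) => t; rewrite dxE.
Qed.

Lemma y_O j : (j <= m.+1)%N -> vO e 1 (fun t => y j t - xs).
Proof.
case: j => [_|j jm]; first exact: y0_O.
by apply: vO_ext (vOD (dx_O jm) y0_O) => t; rewrite /dx addrA subrK.
Qed.

Lemma r0E t : r 0%N t = h (y 0%N t).
Proof. by rewrite /r /lincomb big_ord0 addr0. Qed.

Lemma cyc_r_O j : (j <= m)%N -> vO e 1 (r j).
Proof. by case/cycle_boundsP. Qed.

Lemma cyc_al_O j i : (i < j <= m)%N -> isO e 0 (al j i).
Proof. by case/andP => ij /cycle_boundsP[_ _ h1 _]; exact: h1. Qed.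

Lemma cyc_s_def j t : (j <= m)%N ->
  s j t = lincomb j (fun i => al j i t) (fun i => s i t + r i t).
Proof.
move=> jm; apply: eq_bigr => i _; rewrite dxE //.
exact: leq_trans (ltnW (ltn_ord i)) jm.
Qed.

Lemma cyc_r_affine j : (j <= m)%N ->
  vO e 2 (fun t => r j t - (r 0%N t - A *m s j t)).
Proof.
by case/cycle_boundsP => _ _ _ h1; apply: vO_ext h1 => t; rewrite r0E.
Qed.

Lemma cyc_r_orth i j : (i < j <= m)%N ->
  isO e 3 (fun t => vdot (r j t) (A *m (s i t + r i t))).
Proof.
move=> /[dup] ijm /andP[ij jm].
have im : (i <= m)%N := leq_trans (ltnW ij) jm.
have yO := @y_O i.+1 (leq_trans ij (leqW jm)).
apply: isO_ext (@vO_dot _ _ _ _ 1 2 _ _ (cyc_r_O jm) (h_expandO yO y0_O)) => t.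
by rewrite vdotDr -/(dh i t) r_orth_dh // add0r -/(dx i t) dxE.
Qed.

(** r_j is the combination of the increments dx_i in which dx_j has coefficient
    1. *)
Lemma cyc_r_lb j : (j < m)%N ->
  for_small e (fun t => c0 / 2 / M * e t <= enorm (r j t)).
Proof.
move=> jm; apply: for_small_mono h0_lb => t h1.
have := @dx_indep (fun i => if (i < j.+1)%N then
   (if i == j then 1 else - al j i t) else 0) j t jm.
rewrite lincomb_widen // ltnSn eqxx normr1 mulr1 lincombS eqxx scale1r.
have -> : lincomb j (fun i => if i == j then 1 else - al j i t)
   (fun i => dx i t) = - s j t.
  rewrite -sumrN; apply: eq_bigr => i _.
  by rewrite ltn_eqF ?ltn_ord // scaleNr.
rewrite dxE ?(ltnW jm) // addKr => h2.
rewrite mulrAC ler_pdivrMr // mulrC (mulrC _ M).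
by apply: le_trans h2; rewrite mulrC.
Qed.

Let c1 := c0 / 2 / M.
Let c1_gt0 : 0 < c1. Proof. by rewrite !divr_gt0. Qed.

Lemma cyc_descent p : (p < m)%N ->
  Oge e 3 (fun t => let w := s p.+1 t - s p t - r p t in
    vdot (r p.+1 t - A *m r p.+1 t) (w - A *m w)).
Proof.
move=> pm.
exact: (krylov_descent e_gt0 A_sym c0_gt0 A_lb A_ub cyc_r_O cyc_al_O cyc_s_def
   cyc_r_affine cyc_r_orth c1_gt0 cyc_r_lb pm).
Qed.

Lemma cyc_decay : (0 < m)%N -> Oge e 3 (fun t =>
   vdot (r 0%N t) (r 0%N t) - vdot (r 0%N t) (A *m r 0%N t)
   - vdot (r m t) (r m t)).
Proof.
have dec j (jm : (j < m)%N) := eta_decrease A_sym c0_gt0 A_lb A_ub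
   cyc_r_O cyc_al_O cyc_s_def cyc_r_affine cyc_r_orth jm.
move: (leqnn m); move: {-2}m => j; elim: j => // j IH jm _.
have h1 := dec j jm.
case: j => [|j] in IH jm h1 *; first exact: h1.
apply: Oge_mono (OgeD (IH (ltnW jm) isT) h1) _ => t /=.
have : 0 <= vdot (r j.+1 t) (A *m r j.+1 t).
  by apply: le_trans (A_lb _); rewrite mulr_ge0 ?vdot_ge0 // ltW.
lra.
Qed.

(** The new residual is h(y_(m+1)) = (I - A) r_m up to O(e^2), and its square is at
    most |r_0|^2 - r_0 . A r_0 + O(e^3).  The gain r_0 . A r_0 is of order e^2 and
    outweighs the error. *)
Lemma cyc_next_contract : (0 < m)%N ->
  for_small e (fun t => enorm (h (y m.+1 t)) <= enorm (h (y 0%N t))).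
Proof.
move=> m0.
have hm := h_expandO (y_O (leqnn m.+1)) y0_O.
have g1 : vO e 2 (fun t => h (y m.+1 t) - (r m t - A *m r m t)).
  apply: vO_ext (vOB hm (cyc_r_affine (leqnn m))) => t.
  rewrite -/(dx m t) dxE // r0E mulmxDr.
  move: (A *m s m t) (A *m r m t) (h _) (h _) => a b p q.
  by apply/colP => i; rewrite !mxE; ring.
have rO := cyc_r_O (leqnn m).
have g2 : vO e 1 (fun t => r m t - A *m r m t) by apply: vOB => //; exact: vO_mx.
have g3 : isO e 3 (fun t => vdot (h (y m.+1 t)) (h (y m.+1 t)) -
    vdot (r m t - A *m r m t) (r m t - A *m r m t)).
  have e1 := @vO_dot _ _ _ _ 2 1 _ _ g1 g2.
  have e2 := @vO_dot _ _ _ _ 2 1 _ _ g1 (h_O (y_O (leqnn m.+1))).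
  apply: isO_ext (isOD e1 e2) => t.
  move: (r m t - A *m r m t) (h (y m.+1 t)) => a b; rewrite !vdotE (vdotC b a); ring.
have g4 := OgeD (cyc_decay m0) (isO_Oge (isON g3)).
have [C C0 hC] := g4.
have d1 : 0 < c0 * c1 ^+ 2 by rewrite mulr_gt0 // exprn_gt0.
have d2 : 0 < c0 * c1 ^+ 2 / (C + 1) by rewrite divr_gt0 // ltr_wpDl.
apply: (for_small_and_mono _ (for_small_and hC (cyc_r_lb m0))
  (for_small_le e d2)) => t [h1 h2] h3.
have et := e_gt0 t.
have {}h3 : (C + 1) * e t <= c0 * c1 ^+ 2 by rewrite mulrC -ler_pdivlMr // ltr_wpDl.
apply: ler_enorm; rewrite r0E in h1 h2.
have h4 := A_lb (h (y 0%N t)).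
have h5 : c1 ^+ 2 * e t ^+ 2 <= vdot (h (y 0%N t)) (h (y 0%N t)).
  rewrite -exprMn -enorm_sq lerXn2r ?nnegrE ?enorm_ge0 //.
  by rewrite mulr_ge0 ?(ltW c1_gt0) ?(ltW et).
have h6 := contract_sq A_sym c0_gt0 A_lb A_ub (r m t).
have h7 : 0 <= vdot (r m t) (A *m r m t).
  by apply: le_trans (A_lb _); rewrite mulr_ge0 ?vdot_ge0 // ltW.
have h8 := ler_wpM2l (ltW c0_gt0) h5.
have h9 := ler_wpM2r (sqr_ge0 (e t)) h3.
have e3 : 0 <= e t ^+ 3 by rewrite exprn_ge0 // ltW.
have e3E : C * e t ^+ 3 = C * e t * e t ^+ 2 by ring.
have e3E' : e t ^+ 3 = e t * e t ^+ 2 by ring.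
rewrite e3E in h1; rewrite e3E' in e3; lra.
Qed.

Section Objective.
Variables (f : 'cV[R]_n -> R) (Lip LH : R).
Hypothesis Lip_gt0 : 0 < Lip.
Hypothesis f_quad : forall d, eball xs rad (xs + d) ->
  `|f (xs + d) - f xs - 2^-1 * vdot d ((Lip *: A) *m d)| <= LH * enorm d ^+ 3.

Lemma f_quadO (z : T -> 'cV[R]_n) : vO e 1 (fun t => z t - xs) ->
  isO e 3 (fun t => f (z t) - f xs - Lip / 2 * vdot (z t - xs) (A *m (z t - xs))).
Proof.
move=> hz.
have hB : isO e 3 (fun t =>
    LH * (enorm (z t - xs) * enorm (z t - xs) * enorm (z t - xs))).
  apply: (@isOM _ _ _ 0 3); first exact: isO_cst.
  by apply: (@isOM _ _ _ 2 1) => //; exact: (@isOM _ _ _ 1 1).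
apply: isO_le hB; apply: for_small_mono (in_ball hz) => t bz.
have := @f_quad (z t - xs); rewrite addrC subrK => /(_ bz).
rewrite -scalemxAl vdotZr => h1.
rewrite [Lip / 2]mulrC -(mulrA 2^-1 Lip).
apply: le_trans h1 _; apply: le_trans (ler_norm _) _.
by rewrite (_ : enorm _ ^+ 3 = enorm (z t - xs) * enorm (z t - xs) *
  enorm (z t - xs)) //; ring.
Qed.

(** Let a and b be y_(p+2) and g(y_(p+1)) relative to xs.  By convexity of the
    quadratic model, f at b minus f at a is at least L times A a . (b - a).  Here
    A a = - (I - A) r_(p+1) and b - a = - (I - A) w up to O(e^2), which leaves the
    inner product of [krylov_descent]. *)
Lemma cyc_objective p : (p < m)%N ->
  Oge e 3 (fun t => f (y p.+1 t + h (y p.+1 t)) - f (y p.+2 t)).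
Proof.
move=> pm.
have P1O := @y_O p.+1 (leqW pm); have P2O := @y_O p.+2 pm.
have hO := h_O P1O.
pose a t := y p.+2 t - xs; pose b t := y p.+1 t + h (y p.+1 t) - xs.
have bO : vO e 1 b.
  by apply: vO_ext (vOD P1O hO) => t; rewrite /b addrAC.
pose w t := s p.+1 t - s p t - r p t.
pose u t := r p.+1 t - A *m r p.+1 t.
have E1 := cyc_r_affine pm.
have E2 := h_expandO P1O y0_O.
have h1 : vO e 2 (fun t => A *m a t + u t).
  apply: vO_ext (vOD (h_affine0 y0_O) E1) => t.
  rewrite r0E /u /a y_step // !mulmxDr !mulmxN.
  move: (A *m y 0%N t) (A *m xs) (A *m s p.+1 t) (A *m r p.+1 t) => v1 v2 v3 v4.
  by apply/colP => i; rewrite !mxE; ring.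
have h2 : vO e 2 (fun t => (b t - a t) + (w t - A *m w t)).
  apply: vO_ext (vOB E2 E1) => t.
  rewrite r0E -/(dx p t) dxE ?(ltnW pm) // /w /b /a (y_step t pm).
  rewrite (y_step t (ltnW pm)).
  move: (h (y 0%N t + s p t + r p t)) => hp; move: (h (y 0%N t)) => h0.
  move: (y 0%N t) => y0.
  move: (s p t) (r p t) (s p.+1 t) (r p.+1 t) => s1 r1 s2 r2.
  rewrite !mulmxDr !mulmxN; move: (A *m s1) (A *m r1) (A *m s2) => v1 v2 v3.
  by apply/colP => i; rewrite !mxE; ring.
have uO : vO e 1 u.
  by apply: vOB; [|apply: vO_mx]; exact: cyc_r_O.
have g1 := @vO_dot _ _ _ _ 1 2 _ _ (vOB bO P2O) h1.
have g2 := @vO_dot _ _ _ _ 2 1 _ _ h2 uO.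
have g3 : isO e 3 _ := @isOM _ _ _ 0 3 _ _ (isO_cst e Lip) (isOB g1 g2).
have g4 := isOB (f_quadO bO) (f_quadO P2O).
have [C C0 hC] := cyc_descent pm.
have g5 : Oge e 3 (fun t => Lip * vdot (u t) (w t - A *m w t)).
  exists (Lip * C); first by rewrite mulr_ge0 // ltW.
  by apply: for_small_mono hC => t h3; rewrite -mulrA -mulrN ler_pM2l.
apply: Oge_mono (OgeD g5 (OgeD (isO_Oge g3) (isO_Oge g4))) _ => t.
have pos : 0 <= vdot (b t - a t) (A *m (b t - a t)).
  by apply: le_trans (A_lb _); rewrite mulr_ge0 ?vdot_ge0 // ltW.
rewrite -/(a t) -/(b t).
have -> : y p.+1 t + h (y p.+1 t) = b t + xs by rewrite /b subrK.
move: pos; move: (f _) (f _) (f _) => f1 f2 f3.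
move: (a t) (b t) (u t) (w t) => a' b' u' w'.
rewrite !(mulmxDr, mulmxN) !vdotE (A_sym b' a') (vdotC (A *m w') u') (vdotC w' u').
move=> pos; have := ler_wpM2l (ltW Lip_gt0) pos; lra.
Qed.

End Objective.

End Cycle.

(** * From the algorithm to cycles *)

Section CycleExtraction.
Variables (R : realType) (n : nat).

(** Coefficient vectors become functions on nat, so that the vectors of the
    different steps of a cycle, of different sizes, form one family. *)
Definition zero_ext (p : nat) (al : 'cV[R]_p) (i : nat) : R :=
  oapp (fun j : 'I_p => al j 0) 0 (insub i).

Lemma diff_mx_mul (s : nat -> 'cV[R]_n) k0 p (al : 'cV[R]_p) :
  diff_mx s k0 p *m al =
  lincomb p (zero_ext al) (fun i => s (k0 + i.+1)%N - s k0).
Proof.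
apply/colP => i; rewrite !mxE summxE; apply: eq_bigr => j _.
by rewrite !mxE /zero_ext valK /= mulrC.
Qed.

Lemma lsq_orthogonal (u d : 'cV[R]_n) :
  (forall tau : R, vdot u u <= vdot (u + tau *: d) (u + tau *: d)) ->
  vdot u d = 0.
Proof.
move=> h; have := vdot_ge0 d => c0.
have c1 : 0 < vdot d d + 1 by rewrite ltr_wpDl.
have := h (- (vdot u d / (vdot d d + 1))).
rewrite !vdotE (vdotC d u); set b := vdot u d; set c := vdot d d in c0 c1 *.
set t := b / (c + 1); have tE : b = t * (c + 1) by rewrite divfK // gt_eqF.
rewrite tE => h1; have t2 : t ^+ 2 * (c + 2) <= 0 by rewrite expr2; nra.
have : t ^+ 2 <= 0.
  by rewrite -(@pmulr_lle0 _ (c + 2)) // ltr_wpDl.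
rewrite real_exprn_even_le0 ?num_real //= => /eqP ->; by rewrite mul0r.
Qed.

Definition is_cycle (h : 'cV[R]_n -> 'cV[R]_n) (xs : 'cV[R]_n) (m : nat) (M : R)
    (y : nat -> 'cV[R]_n) (al : nat -> nat -> R) : Prop :=
  let dx i := y i.+1 - y 0%N in
  let dh i := h (y i.+1) - h (y 0%N) in
  let r j := h (y 0%N) + lincomb j (al j) dh in
  [/\ 0 < enorm (y 0%N - xs),
      forall j, (j <= m)%N -> y j.+1 = y 0%N + lincomb j (al j) dx + r j,
      forall i j, (i < j <= m)%N -> vdot (r j) (dh i) = 0 &
      forall (b : nat -> R) i, (i < m)%N ->
        enorm (h (y 0%N)) * `|b i| <= M * enorm (lincomb m b dx)].

(** Optimality of the least-squares solution gives the orthogonality.  The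
    independence bound compares a general combination of the columns of X at the
    last step of the cycle with its first column, which is h(y_0); the bounds for
    the earlier steps are the case of zero coefficients. *)
Lemma AAR_cycle (f : 'cV[R]_n -> R) (L : R) (xs : 'cV[R]_n) (m : nat) (M : R)
    (x : nat -> 'cV[R]_n) :
  hstep f L xs = 0 -> (0 < m)%N -> 0 < M -> generated_by_AAR f L m x ->
  (forall k : nat, (0 < mhat m k)%N ->
    (cond_number ((Xmx m x k)^T *m Xmx m x k) <= (M ^+ 2)%:E)%E) ->
  forall c, exists al,
    is_cycle (hstep f L) xs m M (fun i => x (c * m.+1 + i)%N) al.
Proof.
move=> h_xs m0 M0 gen cond c; set k0 := (c * m.+1)%N.
have mhatE p : (p <= m)%N -> mhat m (k0 + p) = p.
  by move=> pm; rewrite /mhat modnMDl modn_small.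
pose h := hstep f L.
pose dx i := x (k0 + i.+1)%N - x k0.
pose dh i := h (x (k0 + i.+1)%N) - h (x k0).
have gE z : gstep f L z = z + h z by [].
have step p : exists b : nat -> R, (p <= m)%N ->
    (forall b' : nat -> R, enorm (h (x k0) + lincomb p b dh) ^+ 2 <=
        enorm (h (x k0) + lincomb p b' dh) ^+ 2) /\
    x (k0 + p.+1)%N = x k0 + lincomb p b dx + (h (x k0) + lincomb p b dh).
  case: p => [|p].
    exists (fun=> 0) => _; split; first by move=> b'; rewrite /lincomb !big_ord0.
    rewrite /lincomb !big_ord0 !addr0.
    have [h1 _] := gen k0; rewrite addn1 h1 ?gE //.
    by have := mhatE 0%N (leq0n m); rewrite addn0.
  case: (leqP p.+1 m) => [pm|_]; last by exists (fun=> 0).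
  have [_ ] := gen (k0 + p.+1)%N.
  rewrite /Hmx /Gmx mhatE // addnK => /(_ isT)[alpha [lsq xE]].
  exists (zero_ext alpha) => _; split.
    move=> b'; have := lsq (\col_(i < p.+1) b' i).
    rewrite !diff_mx_mul.
    rewrite [X in _ <= enorm (_ + X) ^+ 2 -> _](@lincomb_eq _ _ _ _ b') // => i ip.
    by rewrite /zero_ext insubT /= mxE.
  rewrite addnS xE diff_mx_mul gE.
  have -> : lincomb p.+1 (zero_ext alpha)
      (fun i => gstep f L (x (k0 + i.+1)%N) - gstep f L (x k0)) =
    lincomb p.+1 (zero_ext alpha) dx + lincomb p.+1 (zero_ext alpha) dh.
    rewrite -big_split; apply: eq_bigr => i _ /=.
    by rewrite -scalerDr !gE /dx /dh opprD addrACA.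
  by rewrite addrACA.
have [al hal] := choice step.
have dx0 : dx 0%N = h (x k0).
  have [_] := hal 0%N (leq0n m); rewrite /lincomb !big_ord0 !addr0 /dx => ->.
  by rewrite addrAC subrr add0r.
have hX : (cond_number ((diff_mx x k0 m)^T *m diff_mx x k0 m) <= (M ^+ 2)%:E)%E.
  have := cond (k0 + m)%N; rewrite /Xmx mhatE // addnK; exact.
pose e0 : 'cV[R]_m := delta_mx (Ordinal m0) 0.
have Xe0 : diff_mx x k0 m *m e0 = h (x k0).
  by rewrite -colE -dx0; apply/colP => i; rewrite !mxE.
have e01 : enorm e0 = 1.
  apply/eqP; rewrite -(@eqrXn2 _ 2) ?enorm_ge0 ?ler01 // enorm_sq expr1n.
  rewrite /vdot (bigD1 (Ordinal m0)) //= big1 => [|i i0].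
    by rewrite !mxE !eqxx /= mulr1 addr0.
  by rewrite !mxE (negbTE i0) /= mulr0.
have e0n : e0 != 0 by rewrite -enorm_eq0 e01 oner_eq0.
have gram := cond_number_gram m0 (ltW M0) hX.
exists al; rewrite /is_cycle addn0 -/h; split.
- rewrite lt_neqAle enorm_ge0 andbT eq_sym enorm_eq0 subr_eq0.
  apply/eqP => yxs; have [] := gram 0 e0 e0n.
  by rewrite Xe0 yxs /h h_xs enorm0 ltxx.
- by move=> j jm; have [_ ->] := hal j jm.
- move=> i j /andP[ij jm]; apply: lsq_orthogonal => tau.
  have [lsq _] := hal j jm.
  have := lsq (fun l => al j l + tau * (l == i)%:R).
  rewrite lincombD lincombZ addrA !enorm_sq.
  rewrite [X in tau *: X](_ : _ = dh i) //.
  rewrite /lincomb (bigD1 (Ordinal ij)) //= eqxx scale1r big1 ?addr0 // => l li.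
  by rewrite (_ : (l == i :> nat) = false) ?scale0r //; exact: negbTE.
- move=> b i im; pose w : 'cV[R]_m := \col_(l < m) b l.
  have bw : `|b i| <= enorm w.
    by have := coord_le_enorm w (Ordinal im); rewrite mxE.
  have XwE : diff_mx x k0 m *m w = lincomb m b dx.
    rewrite diff_mx_mul; apply: lincomb_eq => l lm.
    by rewrite /zero_ext insubT /= mxE.
  have [w0|w0] := eqVneq w 0.
    move: bw; rewrite w0 enorm0 normr_le0 => /eqP ->.
    by rewrite normr0 mulr0 mulr_ge0 ?enorm_ge0 // ltW.
  have [_] := gram e0 w w0; rewrite Xe0 e01 mulr1 XwE; apply: le_trans.
  by rewrite ler_wpM2l ?enorm_ge0.
Qed.

End CycleExtraction.

(** * Local estimates and conclusion *)

Section LocalEstimates.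
Variables (R : realType) (n : nat) (f : 'cV[R]_n -> R).
Variables (r : R) (xs : 'cV[R]_n) (L mu LH : R) (m : nat) (M : R).
Hypothesis f_diff : forall x, differentiable f x.
Hypothesis r_gt0 : 0 < r.
Hypothesis xs_stat : grad f xs = 0.
Hypothesis L_gt0 : 0 < L.
Hypothesis f_lip : grad_lipschitz f L.
Hypothesis mu_gt0 : 0 < mu.
Hypothesis f_cvx : strongly_convex_on (eball xs r) mu f.
Hypothesis f_hess : hess_lipschitz_on (eball xs r) LH f.
Hypothesis m_gt0 : (0 < m)%N.
Hypothesis M_gt0 : 0 < M.

Let h := hstep f L.

(** The family consists of all cycles, together with their coefficients, so that
    the constants below depend on the problem data alone. *)
Lemma cycle_local : exists C C2 c2 d : R,
  [/\ 0 <= C, 0 <= C2, 0 < c2, 0 < d &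
   forall y al, is_cycle h xs m M y al -> enorm (y 0%N - xs) <= d ->
   [/\ forall p, (p < m)%N ->
         f (y p.+2) <= f (gstep f L (y p.+1)) + C * enorm (y 0%N - xs) ^+ 3,
       enorm (h (y m.+1)) <= enorm (h (y 0%N)),
       enorm (y m.+1 - xs) <= C2 * enorm (y 0%N - xs) &
       c2 * enorm (y 0%N - xs) <= enorm (h (y 0%N))]].
Proof.
have [Q QE] : exists Q, Q = hess f xs by eexists.
pose A := L^-1 *: Q.
have L0 : L != 0 by rewrite gt_eqF.
have LA : L *: A = Q by rewrite scalerA divff // scale1r.
have AE u v : vdot u (A *m v) = L^-1 * vdot u (Q *m v).
  by rewrite -scalemxAl vdotZr.
have A_sym u v : vdot u (A *m v) = vdot v (A *m u).
  by rewrite !AE (hess_sym f_diff r_gt0 f_hess QE).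
have Li : 0 < L^-1 by rewrite invr_gt0.
pose c0 := L^-1 * mu.
have c0_gt0 : 0 < c0 by rewrite mulr_gt0.
have A_lb u : c0 * vdot u u <= vdot u (A *m u).
  by rewrite AE -mulrA ler_pM2l // (hess_ge f_diff r_gt0 f_hess xs_stat QE).
have A_ub u : vdot u (A *m u) <= vdot u u.
  rewrite AE ler_pdivrMl //; exact: (hess_le r_gt0 f_hess xs_stat QE).
pose K := L^-1 * `|LH|.
have K0 : 0 <= K by rewrite mulr_ge0 // ltW.
have h_expand x y : eball xs r x -> eball xs r y ->
    enorm (h x - h y + A *m (x - y)) <=
      K * (enorm (x - xs) + enorm (y - xs)) * enorm (x - y).
  move=> bx bY; have := grad_expand r_gt0 f_hess QE bx bY.
  have -> : h x - h y + A *m (x - y) =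
      - (L^-1 *: (grad f x - grad f y - Q *m (x - y))).
    rewrite /h /hstep /A -scalemxAl; move: (Q *m (x - y)) => q.
    by apply/colP => i; rewrite !mxE; ring.
  rewrite enormN enormZ (gtr0_norm Li) /K -!mulrA => h1.
  by rewrite ler_pM2l.
have h_xs : h xs = 0 by rewrite /h /hstep xs_stat scaler0 oppr0.
have f_quad d : eball xs r (xs + d) ->
    `|f (xs + d) - f xs - 2^-1 * vdot d ((L *: A) *m d)| <= `|LH| * enorm d ^+ 3.
  by rewrite LA; exact: (f_expand f_diff r_gt0 f_hess xs_stat QE).
pose T := {ya : (nat -> 'cV[R]_n) * (nat -> nat -> R) | is_cycle h xs m M ya.1 ya.2}.
pose y i (t : T) := (sval t).1 i.
pose al j i (t : T) := (sval t).2 j i.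
pose e (t : T) := enorm (y 0%N t - xs).
have e_gt0 t : 0 < e t by case: (svalP t).
have eE t : e t = enorm (y 0%N t - xs) by [].
pose dx i t := y i.+1 t - y 0%N t.
pose dh i t := h (y i.+1 t) - h (y 0%N t).
pose s j t := lincomb j (fun i => al j i t) (fun i => dx i t).
pose r' j t := h (y 0%N t) + lincomb j (fun i => al j i t) (fun i => dh i t).
have y_step j t : (j <= m)%N -> y j.+1 t = y 0%N t + s j t + r' j t.
  by case: (svalP t) => _ + _ _; exact.
have orth i j t : (i < j <= m)%N -> vdot (r' j t) (dh i t) = 0.
  by case: (svalP t) => _ _ + _; exact.
have indep (b : nat -> R) i t : (i < m)%N ->
    enorm (h (y 0%N t)) * `|b i| <= M * enorm (lincomb m b (fun i => dx i t)).
  by case: (svalP t) => _ _ _; exact.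
have obj p (pm : (p < m)%N) :=
  cyc_objective e_gt0 A_sym c0_gt0 A_lb A_ub r_gt0 K0 h_expand h_xs M_gt0 eE
    y_step orth indep L_gt0 f_quad pm.
have [C C0 hC] := Oge_forall e_gt0 obj.
have hN := cyc_next_contract e_gt0 A_sym c0_gt0 A_lb A_ub r_gt0 K0 h_expand h_xs
   M_gt0 eE y_step orth indep m_gt0.
have [C2 C20 hC2] := y_O e_gt0 c0_gt0 A_lb r_gt0 K0 h_expand h_xs M_gt0 eE
   y_step orth indep (leqnn m.+1).
have hlb := h0_lb e_gt0 c0_gt0 A_lb r_gt0 K0 h_expand h_xs eE.
have [d d0 hd] := for_small_and (for_small_and hC hN) (for_small_and hC2 hlb).
have c02 : 0 < c0 / 2 by rewrite divr_gt0.
exists C, C2, (c0 / 2), d; split; [exact: C0|exact: C20|exact: c02|exact: d0|].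
move=> y' al' cyc ed.
have [[h1 h2] [h3 h4]] := hd (exist _ (y', al') cyc) ed.
split; [|exact: h2| |exact: h4].
  move=> p pm; have := h1 p pm.
  rewrite lerBrDr addrC -lerBrDr opprK; exact.
by rewrite ger0_norm ?enorm_ge0 // in h3.
Qed.

Lemma hstep_le x : enorm (h x) <= enorm (x - xs).
Proof.
have := f_lip x xs; rewrite xs_stat subr0 /h /hstep enormN enormZ.
by rewrite gtr0_norm ?invr_gt0 // ler_pdivrMl.
Qed.

End LocalEstimates.

Theorem theorem3p6 (R : realType) (n : nat) (f : 'cV[R]_n -> R)
    (r : R) (xstar : 'cV[R]_n) (L mu LH : R) (m : nat) (M : R)
    (f_C1 : continuously_differentiable f)
    (r_gt0 : 0 < r)
    (xstar_stationary : grad f xstar = 0)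
    (L_gt0 : 0 < L)
    (A1 : grad_lipschitz f L)
    (mu_gt0 : 0 < mu)
    (A2 : strongly_convex_on (eball xstar r) mu f)
    (A3 : hess_lipschitz_on (eball xstar r) LH f)
    (m_ge1 : (1 <= m)%N)
    (M_gt0 : 0 < M) :
  exists (U : set 'cV[R]_n) (C : R),
    [/\ nbhs xstar U, 0 < C &
      forall x : nat -> 'cV[R]_n,
        generated_by_AAR f L m x ->
        U (x 0%N) ->
        (forall k : nat, (0 < mhat m k)%N ->
          (cond_number ((Xmx m x k)^T *m Xmx m x k) <= (M ^+ 2)%:E)%E) ->
        forall k : nat,
          f (x k.+1) <= f (gstep f L (x k))
                        + C * enorm (grad f (x (k - mhat m k)%N)) ^+ 3].
Proof.
have [f_diff _] := f_C1.
have [C [C2 [c2 [d [C0 C20 c20 d0 loc]]]]] := cycle_local f_diff r_gt0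
  xstar_stationary L_gt0 A1 mu_gt0 A2 A3 m_ge1 M_gt0.
have h_xs : hstep f L xstar = 0.
  by rewrite /hstep xstar_stationary scaler0 oppr0.
have C21 : 0 < C2 + 1 by rewrite ltr_wpDl.
pose d' := Num.min d (c2 * d / (C2 + 1)).
have d'0 : 0 < d' by rewrite lt_min d0 divr_gt0 // mulr_gt0.
pose D := (C + 1) / (c2 * L) ^+ 3.
have D0 : 0 < D by rewrite divr_gt0 ?exprn_gt0 ?mulr_gt0 // ltr_wpDl.
(* With d' chosen this way, |h| <= d' at the start of a cycle bounds the distance
   at its end by d. *)
exists (eball xstar d'), D; split => //.
  apply/nbhs_ballP; exists (d' / (n%:R + 1)) => /=.
    by rewrite divr_gt0 // ltr_wpDl.
  move=> z; rewrite -ball_normE /= => hz; rewrite /eball /= enormB.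
  apply: le_lt_trans (enorm_le_mxnorm _) _.
  move: hz; rewrite ltr_pdivlMr ?ltr_wpDl // => hz.
  apply: le_lt_trans hz; rewrite mulrDr mulr1 mulrC lerDl //.
move=> x gen Ux0 cond.
have cyc := AAR_cycle h_xs m_ge1 M_gt0 gen cond.
have inv c : enorm (x (c * m.+1)%N - xstar) <= d /\
             enorm (hstep f L (x (c * m.+1)%N)) <= d'.
  elim: c => [|c [IH1 IH2]].
    rewrite mul0n; split.
      by apply/ltW/(lt_le_trans Ux0); rewrite ge_min lexx.
    exact: le_trans (hstep_le xstar_stationary L_gt0 A1 _) (ltW Ux0).
  have [al hal] := cyc c.
  have := loc _ _ hal; rewrite addn0 => /(_ IH1)[_ h1 h2 h3].
  rewrite mulSn addnC; split; last exact: le_trans h1 IH2.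
  apply: le_trans h2 _.
  have h4 : c2 * enorm (x (c * m.+1)%N - xstar) <= c2 * d / (C2 + 1).
    apply: le_trans h3 (le_trans IH2 _); by rewrite ge_min lexx orbT.
  rewrite ler_pdivlMr // -mulrA ler_pM2l // in h4.
  apply: le_trans h4; rewrite mulrC ler_wpM2l ?enorm_ge0 //.
  by rewrite lerDl.
move=> k; set c := (k %/ m.+1)%N; set p := mhat m k.
have kE : k = (c * m.+1 + p)%N by exact: divn_eq.
have pm : (p <= m)%N by rewrite -ltnS ltn_pmod.
have -> : (k - p)%N = (c * m.+1)%N by rewrite kE addnK.
have rhs0 : 0 <= D * enorm (grad f (x (c * m.+1)%N)) ^+ 3.
  by rewrite mulr_ge0 ?exprn_ge0 ?enorm_ge0 // ltW.
case: (posnP p) => p0.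
  by have [h1 _] := gen k; rewrite h1 // lerDl.
have [al hal] := cyc c; have [IH1 _] := inv c.
have := loc _ _ hal; rewrite addn0 => /(_ IH1)[h1 _ _ h3].
have pm1 : (p.-1 < m)%N by rewrite prednK.
have := h1 _ pm1; rewrite !addnS -addnS prednK // -kE => h4.
apply: le_trans h4 _; rewrite lerD2l.
set e := enorm (x (c * m.+1)%N - xstar) in h3 *.
have e0 : 0 <= e by exact: enorm_ge0.
set g := enorm (grad f (x (c * m.+1)%N)).
have h5 : c2 * L * e <= g.
  move: h3; rewrite /hstep enormN enormZ gtr0_norm ?invr_gt0 // -/g.
  by rewrite -ler_pdivrMl ?invr_gt0 // invrK mulrA (mulrC L).
have cL : 0 < c2 * L by rewrite mulr_gt0.
have h6 : (c2 * L * e) ^+ 3 <= g ^+ 3.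
  have g0 : 0 <= g by exact: enorm_ge0.
  by rewrite lerXn2r ?nnegrE // mulr_ge0 // ltW.
rewrite /D mulrAC ler_pdivlMr ?exprn_gt0 //.
rewrite -mulrA -exprMn (mulrC e); apply: le_trans (ler_wpM2l C0 h6) _.
by rewrite ler_wpM2r ?exprn_ge0 ?enorm_ge0 // lerDl.
Qed.
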